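(* Let $X$ be a separable metric space, let $n\ge1$ be an integer and let $n<p\le\infty$. If $f\in N^{1,p}(\mathbb{B}^n,X)$ is continuous, then $f(\mathbb{B}^n)$ is $n$-rectifiable and has finite $n$-packing content.
   Context: $\mathbb{B}^n$ is the closed unit ball of $\mathbb{R}^n$ centered at the origin. Hausdorff measure: $\mathcal{H}^s(A)=\lim_{\delta\to0}\inf\{\sum_i(\operatorname{diam}U_i)^s: A\subset\bigcup_iU_i,\ \operatorname{diam}U_i\le\delta\}$. Newtonian-Sobolev maps: regard $X$ as a subset of a Banach space $V$ via an isometric (Kuratowski) embedding. For a Borel set $\Omega\subset\mathbb{R}^n$ and $1\le p\le\infty$, $u\in N^{1,p}(\Omega,X)$ means that $u:\Omega\to X$ lies in $L^p(\Omega,V)$ and there is a Borel function $\rho:\Omega\to[0,\infty]$, $\rho\in L^p(\Omega)$, with $d_X(u(\gamma(a)),u(\gamma(b)))\le\int_\gamma\rho\,ds$ for $p$-a.e. rectifiable curve $\gamma:[a,b]\to\Omega$. Here ''$p$-a.e. curve'' means all curves outside a family $\Gamma$ of $p$-modulus zero, where $\mathrm{Mod}_p(\Gamma)=\inf\|g\|_{L^p}^p$ (for $p=\infty$, $\inf\|g\|_{L^\infty}$), the infimum being over Borel $g\ge0$ with $\int_\gamma g\,ds\ge1$ for every rectifiable $\gamma\in\Gamma$. A metric space $Y$ is $n$-rectifiable if there are countably many Lipschitz maps $f_i:E_i\to Y$, $E_i\subset[0,1]^n$, with $\mathcal{H}^n(Y\setminus\bigcup_if_i(E_i))=0$. A metric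 space $Y$ has finite $s$-packing content if there is $M\in(0,\infty)$ such that $\sum_ir(B_i)^s<M$ for every countable collection of mutually disjoint closed balls $B_i\subset Y$ (centered in $Y$) with radii $r(B_i)\le\operatorname{diam}Y$. The set $f(\mathbb{B}^n)$ is regarded as a metric space with the restricted metric. *)

(* Defs.v *)
From HB Require Import structures.
From mathcomp Require Import all_boot all_order all_algebra.
From mathcomp Require Import all_classical all_reals all_analysis.
From mathcomp Require Import measurable_realfun.

Set Implicit Arguments.
Unset Strict Implicit.
Unset Printing Implicit Defensive.

Import Order.TTheory GRing.Theory Num.Theory.
Import numFieldNormedType.Exports.

Local Open Scope classical_set_scope.
Local Open Scope ring_scope.

(* The library norm of 'rV[R]_n is the sup norm: it induces the topology, but
   lengths, balls and Lipschitz constants are taken with respect to [enorm]. *)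
Definition enorm (R : realType) (n : nat) (x : 'rV[R]_n) : R :=
  Num.sqrt (\sum_(i < n) x ord0 i ^+ 2).

Definition unit_ball (R : realType) (n : nat) : set 'rV[R]_n :=
  [set x | enorm x <= 1].

Definition unit_cube (R : realType) (n : nat) : set 'rV[R]_n :=
  [set x | forall i, 0 <= x ord0 i <= 1].

Notation borel_rV R n := (g_sigma_algebraType (@open 'rV[R]_n)).

Definition measure_pushforward d1 d2 (T1 : measurableType d1)
    (T2 : measurableType d2) (R : realType) (m : {measure set T1 -> \bar R})
    (f : T1 -> T2) (mf : measurable_fun [set: T1] f) :
    {measure set T2 -> \bar R} :=
  measure_function_pushforward__canonical__measure_function_Measure m mf.

Section cons_measure.
Context (R : realType) (n : nat).
Local Notation T := (measurableTypeR R).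
Variable m : {sigma_finite_measure set (n.-tuple T) -> \bar R}.

Definition cons_pair (x : T * n.-tuple T) : n.+1.-tuple T :=
  [tuple of x.1 :: x.2].

Lemma measurable_cons_pair : measurable_fun [set: T * n.-tuple T] cons_pair.
Proof.
by apply: measurable_cons; [exact: measurable_fst|exact: measurable_snd].
Qed.

Definition cons_measure : set (n.+1.-tuple T) -> \bar R :=
  pushforward (@lebesgue_measure R \x m)%E cons_pair.

Let mu : {measure set (n.+1.-tuple T) -> \bar R} :=
  measure_pushforward (@lebesgue_measure R \x m)%E measurable_cons_pair.

Let cons_measure0 : cons_measure set0 = 0%E.
Proof. exact: (measure0 mu). Qed.

Let cons_measure_ge0 A : (0 <= cons_measure A)%E.
Proof. exact: (measure_ge0 mu). Qed.

Let cons_measure_sigma_additive : semi_sigma_additive cons_measure.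
Proof. exact: (@measure_semi_sigma_additive _ _ _ mu). Qed.

HB.instance Definition _ := isMeasure.Build _ _ _ cons_measure
  cons_measure0 cons_measure_ge0 cons_measure_sigma_additive.

Let cons_measure_sigma_finite : sigma_finite setT cons_measure.
Proof.
have [F [FT ndF Foo]] :=
  (sigma_finiteP _ _).1 (sigma_finiteT (@lebesgue_measure R)).
have [G [GT ndG Goo]] := (sigma_finiteP _ _).1 (sigma_finiteT m).
pose g (t : n.+1.-tuple T) := (thead t, [tuple of behead t]).
have gK : cancel cons_pair g.
  by move=> [x t]; rewrite /g /cons_pair/= theadE; congr pair; apply: val_inj.
have mg : measurable_fun setT g.
  apply/measurable_fun_pair; first exact: measurable_tnth.
  exact: measurable_behead.
exists (fun k => g @^-1` (F k `*` G k)).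
  rewrite -preimage_bigcup (_ : \bigcup_k _ = setT) ?preimage_setT//.
  rewrite -subTset => -[x y] _.
  have [i _ Fx] : (\bigcup_k F k) x by rewrite -FT.
  have [j _ Gy] : (\bigcup_k G k) y by rewrite -GT.
  exists (maxn i j) => //; split.
    by move: x Fx; exact/subsetPset/ndF/leq_maxl.
  by move: y Gy; exact/subsetPset/ndG/leq_maxr.
move=> k; have [mF Fk] := Foo k; have [mG Gk] := Goo k; split.
  by rewrite -[X in measurable X]setTI; apply: mg => //; exact: measurableX.
rewrite /cons_measure /pushforward -comp_preimage.
rewrite (_ : g \o cons_pair = id); last exact/funext.
rewrite preimage_id product_measure1E//.
by rewrite lte_mul_pinfty// ge0_fin_numE.
Qed.

HB.instance Definition _ := Measure_isSigmaFinite.Build _ _ _ cons_measure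
  cons_measure_sigma_finite.
End cons_measure.

Fixpoint lebesgue_tuple (R : realType) (n : nat) :
    {sigma_finite_measure set (n.-tuple (measurableTypeR R)) -> \bar R} :=
  match n with
  | 0 => \d_[tuple]
  | k.+1 => cons_measure (lebesgue_tuple R k)
  end.

Lemma lebesgue_tuple_box (R : realType) (n : nat)
    (A : 'I_n -> set (measurableTypeR R)) : (forall i, measurable (A i)) ->
  lebesgue_tuple R n [set t | forall i, A i (tnth t i)] =
  (\prod_(i < n) lebesgue_measure (A i))%E.
Proof.
elim: n A => [|n IH] A mA /=.
  by rewrite big_ord0 diracE mem_set//; case.
rewrite big_ord_recl -IH; last by move=> i; exact: mA.
rewrite -product_measure1E//=; last first.
  rewrite (_ : [set t | _] = \bigcap_(i in [set: 'I_n])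
      ((tnth (T:=_))^~ i @^-1` A (lift ord0 i))).
    apply: fin_bigcap_measurable => [|i _]; first exact: finite_finset.
    by rewrite -[X in measurable X]setTI; apply: measurable_tnth.
  by apply/seteqP; split => t h i => [_|]; exact: h.
rewrite /cons_measure /pushforward; congr (product_measure1 _ _ _).
apply/seteqP; split => -[x t] /= h.
  split; first exact: (h ord0).
  by move=> i; have := h (lift ord0 i); rewrite /cons_pair tnthS.
move=> i; case: (unliftP ord0 i) => [j ->|->]; last exact: h.1.
by rewrite /cons_pair tnthS; exact: h.2.
Qed.

Section lebesgue_rV.
Context (R : realType) (n : nat).
Local Notation T := (measurableTypeR R).

Definition row_of_tuple (t : n.-tuple (measurableTypeR R)) : borel_rV R n :=
  \row_i tnth t i.

Lemma measurable_row_of_tuple : measurable_fun setT row_of_tuple.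
Proof.
apply: measurability; first by reflexivity.
move=> _ [U oU <-]; rewrite setTI.
pose box (qk : 'rV[rat]_n * nat) : set 'rV[R]_n :=
  [set x | forall i, `|ratr (qk.1 ord0 i) - x ord0 i| < qk.2.+1%:R^-1].
have -> : row_of_tuple @^-1` U = \bigcup_qk
    (if `[< box qk `<=` U >] then row_of_tuple @^-1` box qk else set0).
  apply/seteqP; split => [t Ut|t [qk _]]; last by case: asboolP => [bU /bU|].
  have /nbhs_ballP[e /= e0 eU] : nbhs (row_of_tuple t) U.
    exact: open_nbhs_nbhs.
  pose k := Num.truncn (2 / e).
  have ke : k.+1%:R^-1 < e / 2.
    rewrite -[ltRHS]invrK ltf_pV2 ?posrE ?invr_gt0 ?divr_gt0//.
    by rewrite invf_div truncnS_gt.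
  have [q qP] : exists q : 'rV[rat]_n,
      forall i, `|ratr (q ord0 i) - tnth t i| < k.+1%:R^-1.
    have qi i : exists q : rat, `|ratr q - tnth t i| < k.+1%:R^-1.
      have lt2 : tnth t i - k.+1%:R^-1 < tnth t i + k.+1%:R^-1.
        by rewrite ltrD2l gtrN ?invr_gt0.
      have [q] := rat_in_itvoo lt2; rewrite in_itv/= => /andP[q1 q2].
      by exists q; rewrite ltr_distl q1.
    exists (\row_i sval (cid (qi i))) => i.
    by rewrite mxE; exact: svalP (cid (qi i)).
  exists (q, k) => //; case: asboolP => [_ i|]; first by rewrite mxE; exact: qP.
  case => x bx; apply: eU; split => // i j; rewrite (ord1 i) mxE.
  have -> : e = e / 2 + e / 2 by rewrite -splitr.
  rewrite /ball/= -[tnth t j](subrK (ratr (q ord0 j))) -addrA.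
  apply: le_lt_trans (ler_normD _ _) _; apply: ltrD; apply: lt_trans ke.
    by rewrite distrC.
  exact: bx.
apply: countable_bigcupT_measurable; first exact: countableP.
move=> qk; case: asboolP => // _.
rewrite (_ : _ @^-1` _ = \bigcap_(i in [set: 'I_n])
    [set t | `|ratr (qk.1 ord0 i) - tnth t i| < qk.2.+1%:R^-1]); last first.
  apply/seteqP; split => t /= h i; first by move=> _; have := h i; rewrite mxE.
  by rewrite mxE; exact: h.
apply: fin_bigcap_measurable => [|i _]; first exact: finite_finset.
set q := ratr _; set e := _^-1.
rewrite (_ : [set t | _] = (tnth (T:=T))^~ i @^-1` `]q - e, q + e[).
  by rewrite -[X in measurable X]setTI; exact: measurable_tnth.
by apply/seteqP; split => t /=; rewrite in_itv/= -ltr_distlC distrC.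
Qed.

Definition lebesgue_rV : {measure set (borel_rV R n) -> \bar R} :=
  measure_pushforward (lebesgue_tuple R n) measurable_row_of_tuple.

Lemma lebesgue_rV_box (A : 'I_n -> set T) : (forall i, measurable (A i)) ->
  lebesgue_rV [set x | forall i, A i (x ord0 i)] =
  (\prod_(i < n) lebesgue_measure (A i))%E.
Proof.
move=> mA; rewrite -lebesgue_tuple_box//.
rewrite [LHS](_ : _ = lebesgue_tuple R n
  (row_of_tuple @^-1` [set x | forall i, A i (x ord0 i)]))//.
by congr (lebesgue_tuple R n _); apply/seteqP; split => t /= h i;
  have := h i; rewrite mxE.
Qed.

End lebesgue_rV.

Section subset_metric.
Context (R : realType) (X : metricType R) (A : set X).

Let subset_dist (x y : A) : R := mdist (set_val x) (set_val y).

Let subset_dist_ge0 x y : 0 <= subset_dist x y.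
Proof. exact: mdist_ge0. Qed.

Let subset_dist_positivity x y : subset_dist x y = 0 -> x = y.
Proof. by move=> /mdist_positivity; exact: val_inj. Qed.

Let ballE (x : A) d : ball x d = [set y | subset_dist x y < d].
Proof. by rewrite -initial_ballE ballEmdist. Qed.

HB.instance Definition _ := @PseudoMetric_isMetric.Build R (set_type A)
  subset_dist subset_dist_ge0 subset_dist_positivity ballE.

End subset_metric.

Definition separable (T : topologicalType) : Prop :=
  exists D : set T, countable D /\ dense D.

Section metric_notions.
Context (R : realType) (Y : metricType R).
Local Open Scope ereal_scope.

Definition diam (A : set Y) : \bar R :=
  ereal_sup (0 |` [set (mdist xy.1 xy.2)%:E | xy in A `*` A]).

Definition hausdorff_content (s delta : R) (A : set Y) : \bar R :=
  ereal_inf [set \sum_(0 <= i <oo) diam (U i) `^ s |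
    U in [set U : nat -> set Y | A `<=` \bigcup_i U i /\
                                 forall i, diam (U i) <= delta%:E]].

Definition hausdorff_measure (s : R) (A : set Y) : \bar R :=
  lim (hausdorff_content s delta A @[delta --> 0%R^'+]).

Definition lipschitz_rV (n : nat) (E : set 'rV[R]_n) (f : E -> Y) : Prop :=
  exists L : R, forall x y : E,
    (mdist (f x) (f y) <= L * enorm (set_val x - set_val y))%R.

Definition rectifiable (n : nat) : Prop :=
  exists (E : nat -> set 'rV[R]_n) (f : forall i, E i -> Y),
    (forall i, E i `<=` @unit_cube R n /\ lipschitz_rV (f i)) /\
    hausdorff_measure n%:R (~` \bigcup_i range (f i)) = 0.

(* In a general metric space this may be larger than the closure of the open
   ball, which is what the library calls [closed_ball]. *)
Definition mclosed_ball (x : Y) (r : R) : set Y :=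
  [set y | (mdist x y <= r)%R].

Definition finite_packing_content (s : R) : Prop :=
  exists M : R, (0 < M)%R /\
    forall (I : set nat) (c : nat -> Y) (r : nat -> R),
      (forall i, I i -> (0 < r i)%R /\ (r i)%:E <= diam [set: Y]) ->
      trivIset I (fun i => mclosed_ball (c i) (r i)) ->
      \esum_(i in I) ((r i)%:E `^ s) < M%:E.

End metric_notions.

Section newton_sobolev.
Context (R : realType) (n : nat).
Local Notation mu := (lebesgue_rV R n).

(* Only the values of [path] on [start, stop] matter. *)
Record curve := Curve { start : R; stop : R; path : R -> 'rV[R]_n }.

Definition path_length (a b : R) (g : R -> 'rV[R]_n) : \bar R :=
  ereal_sup [set (let F k := g (nth b (a :: s) k) in
                  \sum_(0 <= k < size s) enorm (F k.+1 - F k))%:E |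
             s in itv_partition a b].

Definition curve_length (c : curve) : \bar R :=
  path_length (start c) (stop c) (path c).

Definition rectifiable_curve (D : set 'rV[R]_n) (c : curve) : Prop :=
  [/\ start c <= stop c,
      {within `[start c, stop c], continuous (path c)},
      path c @` `[start c, stop c] `<=` D &
      (curve_length c < +oo)%E].

(* [xget] picks a parameter up to which the curve has length [l]; for a
   rectifiable curve and 0 <= l <= curve_length c one exists, and the point of
   the curve does not depend on the choice. *)
Definition arclength_path (c : curve) (l : R) : 'rV[R]_n :=
  path c (xget (start c) [set t | start c <= t <= stop c /\
                                  path_length (start c) t (path c) = l%:E]).

Definition line_integral (c : curve) (g : 'rV[R]_n -> \bar R) : \bar R :=
  (\int[@lebesgue_measure R]_(l in `[0%R, fine (curve_length c)])
     g (arclength_path c l))%E.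

(* In what follows D is a Borel set; [measurable_fun D] is vacuous otherwise. *)
Definition borel_nneg (D : set (borel_rV R n)) (g : borel_rV R n -> \bar R) :
    Prop :=
  measurable_fun D g /\ forall x, D x -> (0 <= g x)%E.

Definition Lp_norm (D : set (borel_rV R n)) (p : \bar R)
    (g : borel_rV R n -> \bar R) : \bar R :=
  Lnorm mu p (g \_ D).

Definition modulus (D : set 'rV[R]_n) (p : \bar R) (G : set curve) : \bar R :=
  ereal_inf [set (match p with
                  | q%:E => Lp_norm D p g `^ q
                  | _ => Lp_norm D p g
                  end)%E |
    g in [set g | borel_nneg D g /\
                  forall c, G c -> rectifiable_curve D c ->
                    (1 <= line_integral c g)%E]].

Definition ae_curve (D : set 'rV[R]_n) (p : \bar R) (P : curve -> Prop) :
    Prop :=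
  exists G : set curve, modulus D p G = 0%E /\
    forall c, rectifiable_curve D c -> ~ G c -> P c.

Definition Lp_vector (V : completeNormedModType R) (D : set 'rV[R]_n)
    (p : \bar R) (v : 'rV[R]_n -> V) : Prop :=
  (exists s : nat -> borel_rV R n -> V,
     (forall k, finite_set (range (s k)) /\
                forall z, measurable (s k @^-1` [set z])) /\
     {ae mu, forall x, D x -> s k x @[k --> \oo] --> v x}) /\
  (Lp_norm D p (fun x => `|v x|%:E) < +oo)%E.

(* [iota] is the isometric embedding through which X is seen in a Banach
   space. *)
Definition newton_sobolev (X : metricType R) (V : completeNormedModType R)
    (iota : X -> V) (D : set 'rV[R]_n) (p : \bar R) (u : 'rV[R]_n -> X) :
    Prop :=
  Lp_vector D p (iota \o u) /\
  exists rho : 'rV[R]_n -> \bar R,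
    [/\ borel_nneg D rho,
        (Lp_norm D p rho < +oo)%E &
        ae_curve D p (fun c =>
          ((mdist (u (path c (start c))) (u (path c (stop c))))%:E <=
             line_integral c rho)%E)].

End newton_sobolev.

(* Main.v *)
(* The ball is covered by its homothetic copies [cell x t = x + t (B - x)], which
   lie in the ball and have volume [t^n |B|].  Enlarging the upper gradient by a
   multiple of an admissible function for the exceptional family, we get an
   upper gradient P in L^q, n < q < oo, along every segment of B.  Averaging over
   segments gives a Morrey estimate on B, hence by scaling on every cell:
     d(f y, f z) <= C L   for y, z in [cell x t]
     whenever  t^(q-n) int_(cell x t) P^q <= L^q.
   Packing: inside the preimage of a closed ball of radius r centred at f(x)
   there is a cell [cell x t] such that r^n is at most a constant times the
   integral of 1 + P^q over it; preimages of disjoint balls are disjoint, so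
   these bounds can be summed.
   Rectifiability: f is k-Lipschitz on the set of points x such that
   d(f x, f z) <= k t on every [cell x t].  A point outside this set has a cell
   whose image is contained in a ball of radius r > k t, and the Morrey estimate
   gives r^n <= C k^(n-q) int_(cell x t) P^q.  A Vitali covering in the image by
   such balls has total content at most C k^(n-q) int P^q, which tends to 0. *)

Require Import Defs.
From HB Require Import structures.
From mathcomp Require Import all_boot all_order all_algebra.
From mathcomp Require Import all_classical all_reals all_analysis.
From mathcomp Require Import measurable_realfun.
From mathcomp Require Import ess_sup_inf.
From mathcomp Require Import ring lra.

Set Implicit Arguments.
Unset Strict Implicit.
Unset Printing Implicit Defensive.

Import Order.TTheory GRing.Theory Num.Theory.
Import numFieldNormedType.Exports.

Local Open Scope classical_set_scope.
Local Open Scope ring_scope.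

(** * Affine changes of variables *)

Section affine_change_of_variables.
Context {R : realType}.
Local Notation T := (measurableTypeR R).
Local Open Scope ereal_scope.

Lemma measurable_affine (a s : R) :
  measurable_fun [set: T] (fun x : T => (a + s * x)%R : T).
Proof. by apply: measurable_funD => //; apply: measurable_funM. Qed.

(** By uniqueness of Lebesgue measure: [s] times the image measure under x -> a + s x gives every
    interval ]u, v] its length. Positivity of [s] keeps the preimage of such an interval open on the
    left and closed on the right. *)
Lemma lebesgue_measure_affine (a s : R) (A : set T) : (0 < s)%R ->
  measurable A ->
  lebesgue_measure A =
  s%:E * pushforward (@lebesgue_measure R) (fun x : T => (a + s * x)%R : T) A.
Proof.
move=> s0 mA.
pose nu : {measure set T -> \bar R} :=
  measure_pushforward (@lebesgue_measure R) (measurable_affine a s).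
have := @lebesgue_measure_unique R (mscale (NngNum (ltW s0)) nu).
apply=> //= _ [[u v] _ <-] /=.
rewrite /mscale/= /pushforward.
rewrite (_ : _ @^-1` _ = `](u - a) / s, (v - a) / s]%classic)%R; last first.
  apply/seteqP; split => x /=; rewrite !in_itv/= => /andP[h1 h2]; apply/andP.
    rewrite ltr_pdivrMr// ler_pdivlMr// ltrBlDl lerBrDl.
    by rewrite [(x * s)%R]mulrC h1 h2.
  move: h1 h2; rewrite ltr_pdivrMr// ler_pdivlMr// ltrBlDl lerBrDl.
  by rewrite [(x * s)%R]mulrC => -> ->.
rewrite !lebesgue_measure_itv/= !lte_fin ltr_pM2r ?invr_gt0// ltrD2r.
case: ifPn => uv; last by rewrite mule0.
by rewrite -EFinM; congr _%:E; field; rewrite gt_eqF.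
Qed.

Lemma ge0_integral_affine (a s : R) (g : T -> \bar R) : (0 < s)%R ->
  measurable_fun setT g -> (forall x, 0 <= g x) ->
  \int[@lebesgue_measure R]_x g x =
  s%:E * \int[@lebesgue_measure R]_x g (a + s * x)%R.
Proof.
move=> s0 mg g0.
pose nu : {measure set T -> \bar R} :=
  measure_pushforward (@lebesgue_measure R) (measurable_affine a s).
rewrite (eq_measure_integral (mscale (NngNum (ltW s0)) nu)); last first.
  by move=> A mA _; exact: lebesgue_measure_affine.
rewrite ge0_integral_mscale//=; congr (_ * _).
by rewrite (@ge0_integral_pushforward _ _ _ _ _ _ (measurable_affine a s)).
Qed.

Definition tuple_affine n (a : n.-tuple T) (s : R) (t : n.-tuple T) :
  n.-tuple T := [tuple (tnth a i + s * tnth t i)%R | i < n].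

Lemma measurable_tuple_affine n (a : n.-tuple T) s :
  measurable_fun setT (tuple_affine a s).
Proof.
apply/measurable_fun_tnthP => i.
rewrite (_ : _ \o _ = fun t => (tnth a i + s * tnth t i)%R); last first.
  by apply/funext => t; rewrite /= /tuple_affine tnth_mktuple.
apply: measurable_funD => //; apply: measurable_funM => //.
exact: measurable_tnth.
Qed.

(** In dimension n+1 the measure is the image of a product measure under [cons_pair], so Tonelli's
    theorem separates the head coordinate. This is what makes inductions on the dimension
    possible. *)
Lemma ge0_integral_cons_tuple n (g : n.+1.-tuple T -> \bar R) :
  measurable_fun setT g -> (forall x, 0 <= g x) ->
  \int[lebesgue_tuple R n.+1]_t g t =
  \int[@lebesgue_measure R]_x \int[lebesgue_tuple R n]_t g [tuple of x :: t].
Proof.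
move=> mg g0.
have := @ge0_integral_pushforward _ _ _ _ R _ (@measurable_cons_pair R n)
  (@lebesgue_measure R \x lebesgue_tuple R n) setT g measurableT mg.
rewrite preimage_setT => intE.
transitivity (\int[@lebesgue_measure R \x lebesgue_tuple R n]_x
   (g \o @cons_pair R n) x).
  by rewrite -intE//; apply: eq_measure_integral => A mA _.
rewrite fubini_tonelli1//.
  apply: measurableT_comp => //; exact: measurable_cons_pair.
by move=> x; exact: g0.
Qed.

(** Induction on the dimension: the one-variable rule treats the head and contributes one factor
    [s], the induction hypothesis treats the tail. *)
Lemma ge0_integral_tuple_affine n (a : n.-tuple T) (s : R)
    (g : n.-tuple T -> \bar R) : (0 < s)%R ->
  measurable_fun setT g -> (forall x, 0 <= g x) ->
  \int[lebesgue_tuple R n]_t g t =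
  (s ^+ n)%:E * \int[lebesgue_tuple R n]_t g (tuple_affine a s t).
Proof.
move=> s0; elim: n a g => [|n IH] a g mg g0.
  rewrite expr0 mul1e; apply: eq_integral => t _.
  by rewrite (tuple0 t) [in RHS]tuple0.
have mga : measurable_fun setT (g \o tuple_affine a s).
  by apply: measurableT_comp => //; exact: measurable_tuple_affine.
rewrite !ge0_integral_cons_tuple//.
have mc (x : T) : measurable_fun setT (fun t : n.-tuple T => [tuple of x :: t]).
  by apply: measurable_cons => //; exact: measurable_cst.
have mg1 : measurable_fun setT (g \o @cons_pair R n).
  by apply: measurableT_comp => //; exact: measurable_cons_pair.
pose h (x : T) := \int[lebesgue_tuple R n]_t g [tuple of x :: t].
have mh : measurable_fun setT h.
  have := measurable_fun_fubini_tonelli_F (m2 := lebesgue_tuple R n)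
    (g \o @cons_pair R n).
  by apply => // ?; exact: g0.
have h0 x : 0 <= h x by apply: integral_ge0.
rewrite -/(h _) (ge0_integral_affine (thead a) s0 mh h0).
rewrite exprS EFinM -muleA; congr (_ * _).
rewrite -ge0_integralZl//; last 3 first.
- have := measurable_fun_fubini_tonelli_F (m2 := lebesgue_tuple R n)
    (g \o tuple_affine a s \o @cons_pair R n).
  apply; last by move=> ?; exact: g0.
  apply: measurableT_comp => //.
  exact: measurable_cons_pair.
- by move=> x _; exact: integral_ge0.
- by rewrite lee_fin exprn_ge0// ltW.
apply: eq_integral => x _.
rewrite /h (IH [tuple of behead a])//; last by apply: measurableT_comp.
congr (_ * _); apply: eq_integral => t _; congr g.
apply: eq_from_tnth => i; rewrite /tuple_affine tnth_mktuple.
case: (unliftP ord0 i) => [j ->|->].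
  rewrite !tnthS tnth_mktuple tnth_behead; congr (tnth _ _ + _)%R.
  by apply: val_inj; rewrite /= inordK// ltnS.
by rewrite !tnth0.
Qed.

End affine_change_of_variables.

Section affine_rV.
Context {R : realType} {n : nat}.
Local Notation V := (borel_rV R n).
Local Notation mu := (lebesgue_rV R n).
Local Open Scope ereal_scope.

Lemma ge0_integral_rV (g : V -> \bar R) :
  measurable_fun setT g -> (forall x, 0 <= g x) ->
  \int[mu]_x g x = \int[lebesgue_tuple R n]_t g (row_of_tuple t).
Proof.
move=> mg g0.
have := @ge0_integral_pushforward _ _ _ _ R _ (@measurable_row_of_tuple R n)
  (lebesgue_tuple R n) setT g measurableT mg.
by rewrite preimage_setT => <-//; exact: eq_measure_integral.
Qed.

Lemma ge0_integral_rV_affine (a : 'rV[R]_n) (s : R) (g : V -> \bar R) :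
  (0 < s)%R -> measurable_fun setT g -> (forall x, 0 <= g x) ->
  measurable_fun setT (fun y : V => g (a + s *: y)%R) ->
  \int[mu]_x g x = (s ^+ n)%:E * \int[mu]_x g (a + s *: x)%R.
Proof.
move=> s0 mg g0 mga; rewrite !ge0_integral_rV//.
rewrite (ge0_integral_tuple_affine [tuple a ord0 i | i < n] s0)//; last first.
  by apply: measurableT_comp => //; exact: measurable_row_of_tuple.
congr (_ * _); apply: eq_integral => t _; congr g.
by apply/rowP => i; rewrite !mxE !tnth_mktuple.
Qed.

End affine_rV.

(** * The unit ball and its homothetic copies *)

Section unit_ball_geometry.
Context {R : realType} {n : nat}.
Local Notation V := (borel_rV R n).
Local Notation mu := (lebesgue_rV R n).
Local Notation B := (@unit_ball R n).
Implicit Types (a b x y : 'rV[R]_n) (s t : R).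

Lemma measurable_fun_continuous_rV (h : 'rV[R]_n -> 'rV[R]_n) :
  continuous h -> measurable_fun [set: V] (h : V -> V).
Proof.
move=> ch; apply: measurability; first by reflexivity.
move=> _ [U oU <-]; rewrite setTI; apply: sub_sigma_algebra.
by move/continuousP : ch; exact.
Qed.

Lemma continuous_affine_rV a s : continuous (fun x => a + s *: x).
Proof.
move=> x; apply: continuousD; first exact: cst_continuous.
exact: scaler_continuous.
Qed.

Lemma measurable_affine_rV a s :
  measurable_fun [set: V] (fun x : V => a + s *: x : V).
Proof. exact: (measurable_fun_continuous_rV (@continuous_affine_rV a s)). Qed.

Lemma enormZ s x : enorm (s *: x) = `|s| * enorm x.
Proof.
rewrite /enorm -sqrtr_sqr -sqrtrM ?sqr_ge0// mulr_sumr; congr Num.sqrt.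
by apply: eq_bigr => i _; rewrite mxE exprMn.
Qed.

Lemma enorm_ge0 x : 0 <= enorm x.
Proof. exact: sqrtr_ge0. Qed.

Lemma enorm0 : enorm (0 : 'rV[R]_n) = 0.
Proof. by have := enormZ 0 0; rewrite scale0r normr0 mul0r. Qed.

Lemma sqr_sum_ge0 x : 0 <= \sum_(i < n) x ord0 i ^+ 2.
Proof. by apply: sumr_ge0 => i _; exact: sqr_ge0. Qed.

Lemma sqr_enorm x : enorm x ^+ 2 = \sum_(i < n) x ord0 i ^+ 2.
Proof. by rewrite sqr_sqrtr// sqr_sum_ge0. Qed.

Lemma enorm_eq0 x : enorm x = 0 -> x = 0.
Proof.
move=> x0; have := sqr_enorm x; rewrite x0 expr0n/= => /esym/eqP.
rewrite psumr_eq0 => [/allP xi0|i _]; last exact: sqr_ge0.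
apply/rowP => i; rewrite mxE; apply/eqP.
by have := xi0 i (mem_index_enum _); rewrite /= sqrf_eq0.
Qed.

Lemma enorm_leP x (r : R) : 0 <= r ->
  (enorm x <= r) = (\sum_(i < n) x ord0 i ^+ 2 <= r ^+ 2).
Proof.
by move=> r0; rewrite -sqr_enorm ler_pXn2r// nnegrE// enorm_ge0.
Qed.

Lemma unit_ballE x : B x = (\sum_(i < n) x ord0 i ^+ 2 <= 1) :> Prop.
Proof. by rewrite /unit_ball/= enorm_leP// expr1n. Qed.

Lemma unit_ball_convex a b s : 0 <= s <= 1 -> B a -> B b ->
  B (a + s *: (b - a)).
Proof.
move=> /andP[s0 s1]; rewrite !unit_ballE => Ba Bb.
apply: (@le_trans _ _ ((1 - s) * \sum_(i < n) a ord0 i ^+ 2 +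
                       s * \sum_(i < n) b ord0 i ^+ 2)).
  rewrite !mulr_sumr -big_split/=; apply: ler_sum => i _; rewrite !mxE.
  (* Convexity of the square: in each coordinate the two sides differ by s (1 - s) (a_i - b_i)^2. *)
  rewrite -subr_ge0.
  rewrite [leRHS](_ : _ = s * (1 - s) * (a ord0 i - b ord0 i) ^+ 2); last ring.
  by rewrite mulr_ge0 ?sqr_ge0// mulr_ge0// subr_ge0.
rewrite -[leRHS](subrK s) lerD//.
  by rewrite -[leRHS]mulr1 ler_wpM2l// subr_ge0.
by rewrite -[leRHS]mulr1 ler_wpM2l.
Qed.

Lemma unit_ball_enormB a b : B a -> B b -> enorm (b - a) <= 2.
Proof.
rewrite !unit_ballE => Ba Bb; rewrite enorm_leP//.
apply: (@le_trans _ _ (2 * \sum_(i < n) a ord0 i ^+ 2 +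
                       2 * \sum_(i < n) b ord0 i ^+ 2)); last first.
  by rewrite -mulrDr expr2 ler_pM2l// (_ : 2 = 1 + 1 :> R)// lerD.
rewrite !mulr_sumr -big_split/=; apply: ler_sum => i _; rewrite !mxE.
rewrite -subr_ge0 [leRHS](_ : _ = (a ord0 i + b ord0 i) ^+ 2); last ring.
exact: sqr_ge0.
Qed.

(** The topology on rows is induced by the sup norm, so continuity of the Euclidean norm has to be
    derived from that of the coordinates. *)
Lemma continuous_enorm : continuous (@enorm R n).
Proof.
move=> x; apply: (@continuous_comp _ _ _
  (fun x : 'rV[R]_n => \sum_(i < n) x ord0 i ^+ 2)); last first.
  exact: sqrt_continuous.
apply: (@cvg_big _ _ _ _ _ _ _ (nbhs x)) => [|i _]; first exact: add_continuous.
by apply: (@continuous_comp _ _ _ (fun x : 'rV[R]_n => x ord0 i)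
  (fun r => r ^+ 2)); [exact: coord_continuous | exact: exprn_continuous].
Qed.

Lemma closed_unit_ball : closed B.
Proof.
rewrite (_ : B = enorm (n:=n) @^-1` [set r : R | r <= 1])//.
by apply: preimage_closed => [x _|]; [exact: continuous_enorm|exact: closed_le].
Qed.

Lemma unit_ball_coord x (i : 'I_n) : B x -> `|x ord0 i| <= 1.
Proof.
rewrite unit_ballE (bigD1 i)//= => h.
rewrite -(@ler_pXn2r _ 2)// ?nnegrE// expr1n real_normK ?num_real//.
by apply: le_trans h; rewrite lerDl sumr_ge0// => j _; exact: sqr_ge0.
Qed.

Lemma compact_unit_ball : compact B.
Proof.
apply: bounded_closed_compact; last exact: closed_unit_ball.
exists 1; split; first exact: num_real.
move=> M M1 x Bx /=; rewrite [leLHS]/Num.norm/= mx_normrE.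
apply: bigmax_le => [|[j i] _ /=]; first exact: ltW (lt_trans ltr01 M1).
by rewrite (ord1 j) (le_trans (unit_ball_coord i Bx))// ltW.
Qed.

Lemma measurable_unit_ball : measurable (B : set V).
Proof.
rewrite -[B]setCK; apply: measurableC; apply: sub_sigma_algebra.
exact/closed_openC/closed_unit_ball.
Qed.

Lemma unit_ball0 : B 0.
Proof. by rewrite /unit_ball/= enorm0. Qed.

Lemma closed_box (c d : R) :
  closed [set x : 'rV[R]_n | forall i, `[c, d]%classic (x ord0 i)].
Proof.
have -> : [set x : 'rV[R]_n | forall i, `[c, d]%classic (x ord0 i)] =
    \bigcap_(i in [set: 'I_n])
      ((fun x : 'rV[R]_n => x ord0 i) @^-1` `[c, d]%classic).
  by apply/seteqP; split => x /= h i; [move=> _; exact: h|exact: h].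
apply: closed_bigI => i _; apply: preimage_closed; last exact: interval_closed.
by move=> x _; exact: coord_continuous.
Qed.

Lemma measurable_box (c d : R) :
  measurable ([set x | forall i, `[c, d]%classic (x ord0 i)] : set V).
Proof.
rewrite -[X in measurable X]setCK; apply: measurableC.
apply: sub_sigma_algebra; exact/closed_openC/closed_box.
Qed.

Lemma unit_ball_measure_lty : (mu B < +oo)%E.
Proof.
pose A (i : 'I_n) : set (measurableTypeR R) := `[(-1), 1]%classic.
have mA i : measurable (A i) by exact: measurable_itv.
apply: (@le_lt_trans _ _ (mu [set x | forall i, A i (x ord0 i)])).
  apply: le_measure; rewrite ?inE; [exact: measurable_unit_ball|
    exact: measurable_box|].
  move=> x Bx i; rewrite /A/= in_itv/= -ler_norml; exact: unit_ball_coord.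
rewrite lebesgue_rV_box// (eq_bigr (fun=> 2%:E)); last first.
  move=> i _; rewrite /A lebesgue_measure_itv/= lte_fin ifT; last by lra.
  by rewrite -EFinD; congr _%:E; ring.
suff : (0%E <= \prod_(i < n) (2%:E : \bar R) < +oo)%E by case/andP.
elim/big_ind : _ => /= [|x y /andP[x0 xoo] /andP[y0 yoo]|_ _].
- by rewrite lee01 ltry.
- by rewrite mule_ge0//= lte_mul_pinfty// ge0_fin_numE.
- by rewrite lee_fin ltry andbT.
Qed.

(** The ball contains the cube [0, 1/(n+1)]^n, since there the sum of squares is at most n/(n+1).
    The denominator n+1 also makes sense for n = 0. *)
Lemma unit_ball_measure_gt0 : (0 < mu B)%E.
Proof.
pose A (i : 'I_n) : set (measurableTypeR R) := `[0, n.+1%:R^-1]%classic.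
have mA i : measurable (A i) by exact: measurable_itv.
apply: (@lt_le_trans _ _ (mu [set x | forall i, A i (x ord0 i)])); last first.
  apply: le_measure; rewrite ?inE; [exact: measurable_box|
    exact: measurable_unit_ball|].
  move=> x Ax; rewrite unit_ballE.
  apply: (@le_trans _ _ (\sum_(i < n) n.+1%:R^-1)).
    apply: ler_sum => i _; have := Ax i; rewrite /A/= in_itv/= => /andP[x0 x1].
    apply: (le_trans _ x1); rewrite expr2 ler_piMl// (le_trans x1)//.
    by rewrite invf_le1// ler1n.
  by rewrite sumr_const card_ord -[leLHS]mulr_natl ler_pdivrMr// mul1r ler_nat.
rewrite lebesgue_rV_box//.
elim/big_ind : _ => /= [|x y|i _]; [exact: lte01|exact: mule_gt0|].
rewrite /A lebesgue_measure_itv/= lte_fin invr_gt0 ltr0n/=.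
by rewrite sube0 lte_fin invr_gt0.
Qed.

End unit_ball_geometry.

(** * Integrability of s^(-al) at 0 for al < 1 *)

Section power_integral.
Context {R : realType}.

(** The fundamental theorem of calculus applies on [1/(k+2), 1], where the primitive s^(1 - al) / (1
    - al) is smooth, and monotone convergence lets k tend to infinity. Starting at 1/2 keeps each
    interval nondegenerate. *)
Lemma integral_powRN_le (al : R) : 0 <= al < 1 ->
  (\int[@lebesgue_measure R]_(s in `]0%R, 1%R]) (s `^ (- al))%:E <=
   ((1 - al)^-1)%:E)%E.
Proof.
move=> /andP[al0 al1]; have c0 : 0 < 1 - al by rewrite subr_gt0.
pose F (k : nat) : set (measurableTypeR R) := `[k.+2%:R^-1, 1]%classic.
have F0 k s : F k s -> 0 < s.
  by rewrite /F/= in_itv/= => /andP[+ _]; apply: lt_le_trans; rewrite invr_gt0.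
have FE : `]0%R, 1%R]%classic = \bigcup_k F k.
  apply/seteqP; split => [s /=|s [k _ Fks]]; last first.
    by have := F0 _ _ Fks; move: Fks; rewrite /F/= !in_itv/= => /andP[_ ->] ->.
  rewrite in_itv/= => /andP[s0 s1]; exists (Num.truncn s^-1) => //.
  rewrite /F/= in_itv/= s1 andbT -[leRHS]invrK lef_pV2 ?posrE ?invr_gt0//.
  by rewrite (le_trans (ltW (truncnS_gt _)))// ler_nat.
have mpow (D : set (measurableTypeR R)) : measurable_fun D (fun s => (s `^ (- al))%:E).
  apply/measurable_EFinP; apply: measurable_funTS; exact: measurable_powR.
have ndF : nondecreasing_seq F.
  move=> i j ij; rewrite subsetEset => s; rewrite /F/= !in_itv/= => /andP[si ->].
  by rewrite andbT (le_trans _ si)// lef_pV2 ?posrE// ler_nat !ltnS.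
have mF i : measurable (F i) by exact: measurable_itv.
have p0 i s : F i s -> (0 <= (s `^ (- al))%:E)%E by rewrite lee_fin powR_ge0.
rewrite FE; have /cvg_lim <-// := @ge0_nondecreasing_set_cvg_integral _ _ R F
  (fun s => (s `^ (- al))%:E) (@lebesgue_measure R) ndF mF (fun i => mpow _) p0.
have cpow (b : R) (k : nat) : {in F k, continuous (fun s : R => s `^ b)}.
  move=> s; rewrite inE => /F0 s0.
  apply: differentiable_continuous; apply/derivable1_diffP.
  by have [] := is_derive1_powR b s0.
apply: lime_le.
  apply: ereal_nondecreasing_is_cvgn.
  exact: ge0_nondecreasing_set_nondecreasing_integral.
apply: nearW => k.
have k1 : k.+2%:R^-1 < 1 :> R by rewrite invf_lt1// ltr1n.
rewrite (@continuous_FTC2 _ _ (fun s => (1 - al)^-1 * s `^ (1 - al)))//.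
- rewrite powR1 mulr1 -EFinB lee_fin gerBl.
  by rewrite mulr_ge0 ?powR_ge0// invr_ge0 ltW.
- by apply: continuous_in_subspaceT => s /cpow.
- have cF s : F k s -> (fun s => (1 - al)^-1 * s `^ (1 - al)) @ s -->
      (1 - al)^-1 * s `^ (1 - al).
    by move=> Fs; apply: cvgM; [exact: cvg_cst|apply: (cpow _ k); rewrite inE].
  split.
  + move=> s; rewrite in_itv/= => /andP[s1 s2].
    have s0 : 0 < s by apply: lt_trans s1; rewrite invr_gt0.
    by apply: derivableM; [exact: derivable_cst|have [] := is_derive1_powR (1 - al) s0].
  + apply: cvg_at_right_filter; apply: cF.
    by rewrite /F/= in_itv/= lexx ltW.
  + apply: cvg_at_left_filter; apply: cF.
    by rewrite /F/= in_itv/= lexx ltW.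
- move=> s; rewrite in_itv/= => /andP[s1 s2].
  have s0 : 0 < s by apply: lt_trans s1; rewrite invr_gt0.
  have [dp dv] := is_derive1_powR (1 - al) s0.
  rewrite derive1E deriveM// dv derive_cst scaler0 addr0 /GRing.scale/= mulrA.
  by rewrite mulVf ?gt_eqF// mul1r; congr (_ `^ _); ring.
Qed.

End power_integral.

(** * Homotheties, cells, and the change of variables on cells *)

Section homothety.
Context {R : realType} {n : nat}.
Local Notation V := (borel_rV R n).
Local Notation mu := (lebesgue_rV R n).
Local Notation B := (@unit_ball R n).
Implicit Types (a b x y : 'rV[R]_n) (s t : R).

Lemma lebesgue_rV_sigma_finite : sigma_finite [set: V] mu.
Proof.
exists (fun k => [set x : 'rV[R]_n | forall i, `[- k%:R, k%:R]%classic (x ord0 i)]).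
  apply/esym; rewrite -subTset => x _; exists (Num.truncn `|x|).+1 => // i /=.
  rewrite in_itv/= -ler_norml.
  apply: le_trans (ltW (truncnS_gt _)).
  rewrite [leRHS]/Num.norm/= mx_normrE.
  by rewrite (le_bigmax _ (fun j => `|x j.1 j.2|) (ord0, i)).
move=> k; split; first exact: measurable_box.
rewrite (@lebesgue_rV_box _ _ (fun=> `[- k%:R, k%:R]%classic))//.
suff : (0%E <= \prod_(i < n) (@lebesgue_measure R `[- k%:R, k%:R]%classic%R) < +oo)%E
  by case/andP.
elim/big_ind : _ => /= [|x y /andP[x0 xoo] /andP[y0 yoo]|_ _].
- by rewrite lee01 ltry.
- by rewrite mule_ge0//= lte_mul_pinfty// ge0_fin_numE.
- rewrite measure_ge0/= lebesgue_measure_itv/=.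
  by case: ifP => _; [rewrite -EFinB ltry|exact: lt0y].
Qed.

(* [lebesgue_rV] only carries a measure structure; Tonelli's theorem needs the
   sigma-finite one. *)
Definition sigma_finite_lebesgue_rV : set V -> \bar R := mu.
HB.instance Definition _ := Measure.on sigma_finite_lebesgue_rV.
HB.instance Definition _ := Measure_isSigmaFinite.Build _ _ _
  sigma_finite_lebesgue_rV lebesgue_rV_sigma_finite.

(** Two readings are used: for fixed [t] it is the homothety of centre [x] and ratio [t]; for fixed
    [y] it runs along the segment from [x] to [y] as [t] goes from 0 to 1. *)
Definition homothety x t y := x + t *: (y - x).

Lemma homothetyE x t : homothety x t = fun y => (1 - t) *: x + t *: y.
Proof.
by apply/funext => y; rewrite /homothety scalerBr scalerBl scale1r addrAC addrA.
Qed.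

Lemma homothety_comp x t a s b :
  homothety x t (homothety a s b) = homothety (homothety x t a) s (homothety x t b).
Proof.
apply/rowP => i; rewrite /homothety !mxE; ring.
Qed.

Lemma measurable_homothety x t : measurable_fun [set: V] (homothety x t : V -> V).
Proof. by rewrite homothetyE; exact: measurable_affine_rV. Qed.

Lemma homothetyK x t : t != 0 -> cancel (homothety x t) (homothety x t^-1).
Proof.
move=> t0 y; apply/rowP => i; rewrite /homothety !mxE.
by rewrite [X in _ + _ * X]addrAC subrr add0r mulKf// subrKC.
Qed.

Lemma homothetyVK x t : t != 0 -> cancel (homothety x t^-1) (homothety x t).
Proof. by move=> t0; rewrite -{2}[t]invrK; apply: homothetyK; rewrite invr_eq0. Qed.

Definition cell x t := homothety x t @` B.

Lemma cellE x t : t != 0 -> cell x t = homothety x t^-1 @^-1` B.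
Proof.
move=> t0; apply/seteqP; split => [_ [y By <-]/=|y By]; first by rewrite homothetyK.
by exists (homothety x t^-1 y) => //; rewrite homothetyVK.
Qed.

Lemma measurable_cell x t : t != 0 -> measurable (cell x t : set V).
Proof.
move=> t0; rewrite cellE// -[X in measurable X]setTI.
by apply: measurable_homothety => //; exact: measurable_unit_ball.
Qed.

Lemma cell_sub x t : 0 <= t <= 1 -> B x -> cell x t `<=` B.
Proof. by move=> t01 Bx _ [y By <-]; exact: unit_ball_convex. Qed.

Lemma cell_center x t : B x -> cell x t x.
Proof. by move=> Bx; exists x => //; rewrite /homothety subrr scaler0 addr0. Qed.

(** Joint measurability in ratio and point, as Tonelli's theorem requires. It is checked coordinate
    by coordinate, through [row_of_tuple]. *)
Lemma measurable_homothety2 x : measurable_fun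
  [set: measurableTypeR R * V] ((fun z => homothety x z.1 z.2) : _ -> V).
Proof.
pose h (z : measurableTypeR R * V) : n.-tuple (measurableTypeR R) :=
  [tuple (x ord0 i + z.1 * (z.2 ord0 i - x ord0 i))%R | i < n].
rewrite (_ : (fun z => _) = @row_of_tuple R n \o h); last first.
  by apply/funext => z; apply/rowP => i; rewrite /homothety !mxE tnth_mktuple.
apply: measurableT_comp; first exact: measurable_row_of_tuple.
apply/measurable_fun_tnthP => i.
rewrite (_ : _ \o _ =
  fun z : measurableTypeR R * V => x ord0 i + z.1 * (z.2 ord0 i - x ord0 i));
  last first.
  by apply/funext => z; rewrite /= /h tnth_mktuple.
have mcoord : measurable_fun [set: V] (fun y : V => y ord0 i : measurableTypeR R).
  apply: (measurability _ (RGenOInfty.measurableE R)) => _ [_ [c ->] <-].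
  rewrite setTI; apply: sub_sigma_algebra.
  apply: (@open_comp 'rV[R]_n R (fun y => y ord0 i)); last exact: rray_open.
  by move=> y _; exact: coord_continuous.
apply: measurable_funD => //; apply: measurable_funM => //.
apply: measurable_funB => //.
exact: (measurableT_comp mcoord).
Qed.

Lemma measurable_segment a b (P : V -> \bar R) : measurable_fun setT P ->
  measurable_fun [set: measurableTypeR R] (fun s => P (homothety a s b)).
Proof.
move=> mP.
have mP2 := measurableT_comp mP (@measurable_homothety2 a).
exact: (measurableT_comp mP2 (pair2_measurable (b : V))).
Qed.

Local Open Scope ereal_scope.

Lemma integral_cell x t (g : V -> \bar R) : (0 < t)%R ->
  measurable_fun setT g -> (forall y, 0 <= g y) ->
  \int[mu]_(y in cell x t) g y =
  (t ^+ n)%:E * \int[mu]_(y in B) g (homothety x t y).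
Proof.
move=> t0 mg g0; have tn0 : t != 0%R by rewrite gt_eqF.
have mC := measurable_cell x tn0.
rewrite integral_mkcond [in RHS]integral_mkcond.
have mgC : measurable_fun setT (g \_ (cell x t : set V)).
  by apply/(measurable_restrictT g mC); exact: measurable_funTS.
have gC0 (y : V) : 0 <= (g \_ (cell x t : set V)) y by apply: erestrict_ge0.
rewrite (@ge0_integral_rV_affine _ _ ((1 - t) *: x)%R t _ t0 mgC gC0); last first.
  exact: (measurableT_comp mgC (measurable_affine_rV ((1 - t) *: x)%R t)).
congr (_ * _); apply: eq_integral => y _; rewrite /= /patch.
have -> : ((1 - t) *: x + t *: y)%R = homothety x t y by rewrite homothetyE.
suff -> : (homothety x t y \in cell x t) = (y \in B) by [].
apply/idP/idP; rewrite !inE; last by exists y.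
by rewrite cellE//= homothetyK.
Qed.

Lemma measure_cell x t : (0 < t)%R -> mu (cell x t) = (t ^+ n)%:E * mu B.
Proof.
move=> t0; have tn0 : t != 0%R by rewrite gt_eqF.
have := @integral_cell x t (cst 1) t0.
rewrite !integral_cst ?mul1e//; [exact|exact: measurable_unit_ball|].
exact: measurable_cell.
Qed.

Lemma measurable_integral_homothety x (P : V -> \bar R) :
  measurable_fun setT P -> (forall y, 0 <= P y) ->
  measurable_fun [set: measurableTypeR R]
    (fun s => \int[mu]_(y in B) P (homothety x s y)).
Proof.
move=> mP P0.
pose mu' : {sigma_finite_measure set V -> \bar R} := sigma_finite_lebesgue_rV.
pose f (z : measurableTypeR R * V) : \bar R :=
  ((fun z => P (homothety x z.1 z.2)) \_ (setT `*` B)) z.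
have mf : measurable_fun setT f.
  have mD : measurable (setT `*` (B : set V) : set (measurableTypeR R * V)).
    by apply: measurableX; [exact: measurableT|exact: measurable_unit_ball].
  apply/(measurable_restrictT _ mD).
  apply: measurable_funTS.
  exact: (measurableT_comp mP (@measurable_homothety2 x)).
have f0 z : 0 <= f z by apply: erestrict_ge0.
apply: eq_measurable_fun (measurable_fun_fubini_tonelli_F (m2 := mu') f mf f0).
move=> s _; rewrite [RHS]integral_mkcond; apply: eq_integral => y _.
by rewrite /f /patch in_setX in_setT.
Qed.

Lemma measurable_segment_integral x (P : V -> \bar R) :
  measurable_fun setT P -> (forall y, 0 <= P y) ->
  measurable_fun [set: V] (fun y : V =>
    \int[@lebesgue_measure R]_(s in `]0%R, 1%R]) P (homothety x s y)).
Proof.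
move=> mP P0.
pose f (z : measurableTypeR R * V) : \bar R :=
  ((fun z => P (homothety x z.1 z.2)) \_ (`]0%R, 1%R]%classic `*` setT)) z.
have mf : measurable_fun setT f.
  have mD : measurable (`]0%R, 1%R]%classic `*` setT :
      set (measurableTypeR R * V)).
    by apply: measurableX; [exact: measurable_itv|exact: measurableT].
  apply/(measurable_restrictT _ mD).
  apply: measurable_funTS.
  exact: (measurableT_comp mP (@measurable_homothety2 x)).
have f0 z : 0 <= f z by apply: erestrict_ge0.
have := measurable_fun_fubini_tonelli_G (m1 := @lebesgue_measure R) f mf f0.
apply: eq_measurable_fun => y _; rewrite [RHS]integral_mkcond.
by apply: eq_integral => s _; rewrite /f /patch in_setX in_setT andbT.
Qed.

Lemma tonelli_homothety x (P : V -> \bar R) :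
  measurable_fun setT P -> (forall y, 0 <= P y) ->
  \int[mu]_(y in B) \int[@lebesgue_measure R]_(s in `]0%R, 1%R])
    P (homothety x s y) =
  \int[@lebesgue_measure R]_(s in `]0%R, 1%R]) \int[mu]_(y in B)
    P (homothety x s y).
Proof.
move=> mP P0.
pose mu' : {sigma_finite_measure set V -> \bar R} := sigma_finite_lebesgue_rV.
(* Both domains of integration are moved into the integrand by extending it by 0, so that Tonelli's
   theorem is applied on the whole product space. *)
pose f (z : measurableTypeR R * V) : \bar R :=
  ((fun z => P (homothety x z.1 z.2)) \_ (`]0%R, 1%R]%classic `*` B)) z.
have mf : measurable_fun setT f.
  have mD : measurable (`]0%R, 1%R]%classic `*` (B : set V) :
      set (measurableTypeR R * V)).
    by apply: measurableX; [exact: measurable_itv|exact: measurable_unit_ball].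
  apply/(measurable_restrictT _ mD).
  apply: measurable_funTS.
  exact: (measurableT_comp mP (@measurable_homothety2 x)).
have f0 z : 0 <= f z by apply: erestrict_ge0.
have := @fubini_tonelli _ _ _ _ R (@lebesgue_measure R) mu' f mf f0.
have fE s y : f (s, y) =
    if (s \in `]0%R, 1%R]%classic) && (y \in B) then P (homothety x s y) else 0.
  by rewrite /f /patch in_setX.
move=> fub; rewrite integral_mkcond [RHS]integral_mkcond.
transitivity (\int[mu']_y \int[lebesgue_measure]_s f (s, y)).
  apply: eq_integral => y _; rewrite /patch; case: ifPn => yB.
    rewrite integral_mkcond; apply: eq_integral => s _.
    by rewrite fE yB andbT.
  by rewrite integral0_eq// => s _; rewrite fE (negbTE yB) andbF.
rewrite -fub; apply: eq_integral => s _; rewrite /patch; case: ifPn => sI.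
  rewrite [RHS]integral_mkcond; apply: eq_integral => y _.
  by rewrite fE sI.
by rewrite integral0_eq// => y _; rewrite fE (negbTE sI).
Qed.

End homothety.

(** * The Morrey estimate *)

Section morrey.
Context {R : realType} {n : nat}.
Local Notation V := (borel_rV R n).
Local Notation mu := (lebesgue_rV R n).
Local Notation B := (@unit_ball R n).
Implicit Types (a b x y : 'rV[R]_n) (s t q : R).
Local Open Scope ereal_scope.

(** If P <= l the first term suffices; otherwise P / l >= 1 and P <= l (P / l)^q, which is the
    second term. With a suitable [l] this replaces Hölder's inequality below. *)
Lemma le_young (l q : R) (P : \bar R) : (0 < l)%R -> (1 <= q)%R -> 0 <= P ->
  P <= l%:E + (l `^ (1 - q))%:E * P `^ q.
Proof.
move=> l0 q1; case: P => [p p0||//].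
  rewrite poweR_EFin -EFinM -EFinD lee_fin.
  have [pl|lp] := leP p l; first by rewrite ler_wpDr// mulr_ge0// powR_ge0.
  rewrite lee_fin in p0.
  rewrite ler_wpDl ?(ltW l0)//.
  have -> : (l `^ (1 - q) * p `^ q = l * (p / l) `^ q)%R.
    rewrite powRB ?(gt_eqF l0) ?implybT// powRr1 ?(ltW l0)//.
    have -> : ((p / l) `^ q = p `^ q / l `^ q)%R.
      rewrite powRM ?invr_ge0 ?(ltW l0)//.
      by rewrite -[(l^-1)%R]powR_inv1 ?(ltW l0)// -powRrM mulN1r powRN.
    by ring.
  rewrite mulrC -ler_pdivrMr//.
  have pl : (1 <= p / l)%R by rewrite ler_pdivlMr// mul1r ltW.
  by rewrite -[leLHS]powRr1 ?(le_trans _ pl)// ler_powR.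
move=> _; rewrite poweRyr ?gt_eqF ?(lt_le_trans _ q1)//.
by rewrite gt0_muley ?lte_fin ?powR_gt0// addey// leey.
Qed.

Lemma measurable_poweR_comp (P : V -> \bar R) q :
  measurable_fun setT P -> measurable_fun setT (fun y : V => P y `^ q).
Proof. by move=> mP; exact: (measurableT_comp (measurable_poweR q) mP). Qed.

Lemma ge0_subset_cell (P : V -> \bar R) x t : (0 < t <= 1)%R -> B x ->
  measurable_fun setT P -> (forall y, 0 <= P y) ->
  \int[mu]_(y in cell x t) P y <= \int[mu]_(y in B) P y.
Proof.
move=> /andP[t0 t1] Bx mP P0; apply: ge0_subset_integral => //.
- by apply: measurable_cell; rewrite gt_eqF.
- exact: measurable_unit_ball.
- exact: measurable_funTS.
- by apply: cell_sub => //; rewrite (ltW t0).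
Qed.

(** Young's inequality is integrated over the ball; the change of variables turns the second term
    into s^(-n) times an integral over [cell x s], which is contained in the ball. *)
Lemma integral_homothety_young (P : V -> \bar R) x s (l q : R) :
  (0 < s <= 1)%R -> (0 < l)%R -> (1 <= q)%R -> B x ->
  measurable_fun setT P -> (forall y, 0 <= P y) ->
  \int[mu]_(y in B) P (homothety x s y) <=
  l%:E * mu B + (l `^ (1 - q) * s ^- n)%:E * \int[mu]_(y in B) P y `^ q.
Proof.
move=> /andP[s0 s1] l0 q1 Bx mP P0.
have mB : measurable (B : set V) := measurable_unit_ball.
have mPs : measurable_fun setT (fun y : V => P (homothety x s y)).
  exact: (measurableT_comp mP (@measurable_homothety _ _ x s)).
have mPq := measurable_poweR_comp q mP.
have mPsq := measurable_poweR_comp q mPs.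
apply: (@le_trans _ _ (\int[mu]_(y in B)
    (l%:E + (l `^ (1 - q))%:E * P (homothety x s y) `^ q))).
  apply: ge0_le_integral => //.
  - exact: measurable_funTS.
  - apply: measurable_funTS; apply: emeasurable_funD => //.
    exact: emeasurable_funM.
  - by move=> y _; exact: le_young.
rewrite ge0_integralD//; last 3 first.
- by move=> y _; rewrite lee_fin ltW.
- by move=> y _; rewrite mule_ge0 ?poweR_ge0// lee_fin powR_ge0.
- by apply: measurable_funTS; exact: emeasurable_funM.
rewrite integral_cst// leeD2l// EFinM -muleA.
rewrite ge0_integralZl//; last 3 first.
- exact: measurable_funTS.
- by move=> y _; exact: poweR_ge0.
- by rewrite lee_fin powR_ge0.
rewrite lee_wpmul2l ?lee_fin ?powR_ge0//.
have sn0 : (0 < s ^+ n)%R by rewrite exprn_gt0.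
apply: (@le_trans _ _ ((s ^- n)%:E * \int[mu]_(y in cell x s) P y `^ q)).
  rewrite integral_cell//; last by move=> y; exact: poweR_ge0.
  by rewrite muleA -EFinM mulVf ?gt_eqF// mul1e.
rewrite lee_wpmul2l ?lee_fin ?invr_ge0 ?(ltW sn0)//.
apply: ge0_subset_cell => //; first by rewrite s0.
by move=> y; exact: poweR_ge0.
Qed.

Lemma integral_segments_le (P : V -> \bar R) x (L q : R) :
  (0 < n)%N -> (n%:R < q)%R -> (0 < L)%R -> B x ->
  measurable_fun setT P -> (forall y, 0 <= P y) ->
  \int[mu]_(y in B) P y `^ q <= (L `^ q)%:E ->
  \int[mu]_(y in B) \int[@lebesgue_measure R]_(s in `]0%R, 1%R])
    P (homothety x s y) <=
  ((fine (mu B) + 1) * (1 - n%:R / q)^-1 * L)%:E.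
Proof.
move=> n0 nq L0 Bx mP P0 PL.
have n1 : (1 <= n%:R :> R)%R by rewrite ler1n.
have q1 : (1 <= q)%R by rewrite (le_trans n1)// ltW.
have q0 : (0 < q)%R by rewrite (lt_le_trans _ q1).
set al := (n%:R / q)%R.
have al01 : (0 <= al < 1)%R.
  by rewrite divr_ge0 ?(ltW q0)//= ltr_pdivrMr// mul1r.
have mB : measurable (B : set V) := measurable_unit_ball.
have mufin : mu B = (fine (mu B))%:E.
  by rewrite fineK// ge0_fin_numE// unit_ball_measure_lty.
rewrite tonelli_homothety//.
have mpow : measurable_fun (`]0%R, 1%R]%classic : set (measurableTypeR R))
    (fun s => (s `^ (- al))%:E).
  by apply/measurable_EFinP; apply: measurable_funTS; exact: measurable_powR.
apply: (@le_trans _ _ (\int[@lebesgue_measure R]_(s in `]0%R, 1%R])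
    (((fine (mu B) + 1) * L)%:E * (s `^ (- al))%:E))).
  apply: ge0_le_integral => //.
  - by move=> s _; apply: integral_ge0.
  - by apply: measurable_funTS; exact: measurable_integral_homothety.
  - by apply: emeasurable_funM.
  - move=> s /=; rewrite in_itv/= => /andP[s0 s1].
    (* With this parameter both terms of Young's inequality are multiples of
       s^(-n/q), which is integrable at 0 because n < q. *)
    pose l := (L * s `^ (- al))%R.
    have l0 : (0 < l)%R by rewrite mulr_gt0// powR_gt0.
    have s01 : (0 < s <= 1)%R by rewrite s0.
    apply: (le_trans (integral_homothety_young s01 l0 q1 Bx mP P0)).
    apply: (@le_trans _ _
        (l%:E * mu B + (l `^ (1 - q) * s ^- n)%:E * (L `^ q)%:E)).
      rewrite leeD2l// lee_wpmul2l// lee_fin mulr_ge0 ?powR_ge0//.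
      by rewrite invr_ge0 exprn_ge0// ltW.
    rewrite mufin -!EFinM -EFinD lee_fin.
    rewrite [leRHS](_ : _ = l * fine (mu B) + l)%R; last by rewrite /l; ring.
    rewrite lerD2l.
    rewrite powRB ?(gt_eqF l0) ?implybT// powRr1 ?(ltW l0)//.
    (* By the choice of [l], l^q = L^q s^(-n), so the second term is exactly [l]. *)
    rewrite [X in (_ / X * _ * _)%R](_ : _ = L `^ q * s ^- n)%R.
      rewrite mulrAC -mulrA mulfVK// gt_eqF// mulr_gt0 ?powR_gt0//.
      by rewrite invr_gt0 exprn_gt0.
    rewrite /l powRM ?(ltW L0) ?powR_ge0// -powRrM mulNr /al divfK ?gt_eqF//.
    by rewrite powRN powR_mulrn// ltW.
rewrite ge0_integralZl//; last 2 first.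
- by move=> s _; rewrite lee_fin powR_ge0.
- by rewrite lee_fin mulr_ge0 ?(ltW L0)// addr_ge0// fine_ge0.
rewrite [leRHS](_ : _ = ((fine (mu B) + 1) * L)%:E * ((1 - al)^-1)%:E); last first.
  by rewrite -EFinM; congr _%:E; rewrite /al; ring.
rewrite lee_wpmul2l//; first by rewrite lee_fin mulr_ge0 ?(ltW L0)// addr_ge0// fine_ge0.
exact: integral_powRN_le.
Qed.

End morrey.

Section segment_gradient.
Context {R : realType} {n : nat} {X : metricType R}.
Local Notation V := (borel_rV R n).
Local Notation mu := (lebesgue_rV R n).
Local Notation B := (@unit_ball R n).
Implicit Types (a b x y : 'rV[R]_n) (s t q : R) (F : 'rV[R]_n -> X).
Local Open Scope ereal_scope.

(** An upper gradient tested on all segments of the ball, with no exceptional ones. Segments are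
    parametrised by ]0, 1], whence the factor |b - a|. Measurability of [P] on the whole space
    allows composing it with homotheties. *)
Definition segment_gradient F (P : V -> \bar R) : Prop :=
  [/\ measurable_fun setT P, forall y, 0 <= P y &
   forall a b, B a -> B b -> (mdist (F a) (F b))%:E <=
     (enorm (b - a))%:E *
     \int[@lebesgue_measure R]_(s in `]0%R, 1%R]) P (homothety a s b)].

(** The factor 4 is the diameter 2 of the ball for each of the two endpoints; the middle factor
    comes from [integral_segments_le]; dividing by the volume of the ball turns an integral into an
    average. *)
Definition morrey_constant q : R :=
  (4 * ((fine (mu B) + 1) * (1 - n%:R / q)^-1) / fine (mu B))%R.

Lemma morrey_constant_gt0 q : (0 < n)%N -> (n%:R < q)%R ->
  (0 < morrey_constant q)%R.
Proof.
move=> n0 nq; have q0 : (0 < q)%R by rewrite (le_lt_trans _ nq).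
have m0 : (0 < fine (mu B))%R.
  by rewrite fine_gt0// unit_ball_measure_gt0 unit_ball_measure_lty.
have al : (n%:R / q < 1)%R by rewrite ltr_pdivrMr// mul1r.
apply: divr_gt0 => //; apply: mulr_gt0 => //; apply: mulr_gt0.
  by apply: addr_gt0.
by rewrite invr_gt0 subr_gt0.
Qed.

(** Both F a and F b are compared with F y along segments, and the triangle inequality is integrated
    over all y in the ball. *)
Lemma morrey F (P : V -> \bar R) q (L : R) : (0 < n)%N -> (n%:R < q)%R ->
  segment_gradient F P -> (0 < L)%R ->
  \int[mu]_(y in B) P y `^ q <= (L `^ q)%:E ->
  forall a b, B a -> B b -> (mdist (F a) (F b) <= morrey_constant q * L)%R.
Proof.
move=> n0 nq [mP P0 dP] L0 PL a b Ba Bb.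
have mB : measurable (B : set V) := measurable_unit_ball.
have m0 : (0 < fine (mu B))%R.
  by rewrite fine_gt0// unit_ball_measure_gt0 unit_ball_measure_lty.
have mufin : mu B = (fine (mu B))%:E.
  by rewrite fineK// ge0_fin_numE// unit_ball_measure_lty.
pose h x (y : V) := \int[@lebesgue_measure R]_(s in `]0%R, 1%R]) P (homothety x s y).
have mh x : measurable_fun setT (h x) by exact: measurable_segment_integral.
have h0 x y : 0 <= h x y by exact: integral_ge0.
have dh x y : B x -> B y -> (mdist (F x) (F y))%:E <= 2%:E * h x y.
  move=> Bx By; apply: (le_trans (dP _ _ Bx By)).
  by apply: lee_wpmul2r; [exact: h0|rewrite lee_fin unit_ball_enormB].
pose K := ((fine (mu B) + 1) * (1 - n%:R / q)^-1)%R.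
have ih x : B x -> \int[mu]_(y in B) h x y <= (K * L)%:E.
  by move=> Bx; exact: integral_segments_le.
have main : (mdist (F a) (F b))%:E * mu B <= (4 * K * L)%:E.
  rewrite -integral_cst//.
  apply: (@le_trans _ _ (\int[mu]_(y in B) (2%:E * (h a y + h b y)))).
    apply: ge0_le_integral => //.
    - by move=> y _; rewrite lee_fin mdist_ge0.
    - apply: measurable_funTS; apply: emeasurable_funM => //.
      exact: emeasurable_funD.
    - move=> y By; rewrite /cst ge0_muleDr//.
      apply: (le_trans _ (leeD (dh a y Ba By) (dh b y Bb By))).
      by rewrite -EFinD lee_fin (metric_sym (F b)) metric_triangle.
  rewrite ge0_integralZl//; last 2 first.
  - by apply: measurable_funTS; exact: emeasurable_funD.
  - by move=> y _; rewrite adde_ge0.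
  rewrite ge0_integralD//; try exact: measurable_funTS.
  rewrite [leRHS](_ : _ = 2%:E * ((K * L)%:E + (K * L)%:E)).
    by rewrite lee_wpmul2l// leeD// ih.
  by rewrite -EFinD -EFinM; congr _%:E; ring.
move: main; rewrite mufin -EFinM lee_fin -ler_pdivlMr// => /le_trans; apply.
by rewrite /morrey_constant -/K mulrAC.
Qed.

Lemma segment_gradient_homothety F P x t : B x -> (0 < t <= 1)%R ->
  segment_gradient F P ->
  segment_gradient (F \o homothety x t)
    (fun y : V => t%:E * P (homothety x t y)).
Proof.
move=> Bx /andP[t0 t1] [mP P0 dP].
have mPx y s : measurable_fun setT (fun z : V => P (homothety y s z)).
  exact: (measurableT_comp mP (@measurable_homothety _ _ y s)).
split.
- by apply: emeasurable_funM => //; exact: measurable_cst.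
- by move=> y; rewrite mule_ge0// lee_fin ltW.
move=> a b Ba Bb /=.
have Bxt y : B y -> B (homothety x t y).
  by move=> By; apply: unit_ball_convex => //; rewrite t1 ltW.
apply: (le_trans (dP _ _ (Bxt a Ba) (Bxt b Bb))).
have -> : (homothety x t b - homothety x t a = t *: (b - a))%R.
  by apply/rowP => i; rewrite /homothety !mxE; ring.
rewrite enormZ gtr0_norm// mulrC EFinM -muleA lee_wpmul2l//.
  by rewrite lee_fin enorm_ge0.
rewrite -ge0_integralZl//; last 2 first.
- apply: measurable_funTS; exact: measurable_segment.
- by rewrite lee_fin ltW.
by under [leLHS]eq_integral do rewrite -homothety_comp.
Qed.

(** The estimate on the ball is applied to F composed with the homothety, whose gradient is [P]
    composed with it, times [t]. The q-th power gives t^q and the change of variables t^(-n), hence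
    the weight t^(q - n). *)
Lemma morrey_cell F P x t q (L : R) : (0 < n)%N -> (n%:R < q)%R ->
  segment_gradient F P -> B x -> (0 < t <= 1)%R -> (0 < L)%R ->
  (t `^ (q - n%:R))%:E * \int[mu]_(y in cell x t) P y `^ q <= (L `^ q)%:E ->
  forall y z, cell x t y -> cell x t z ->
  (mdist (F y) (F z) <= morrey_constant q * L)%R.
Proof.
move=> n0 nq sg Bx t01 L0 PL _ _ [y By <-] [z Bz <-].
have /andP[t0 t1] := t01; have [mP P0 _] := sg.
have := morrey n0 nq (segment_gradient_homothety Bx t01 sg) L0.
apply => //; apply: le_trans PL.
have mPq : measurable_fun setT (fun y : V => P y `^ q) by exact: measurable_poweR_comp.
rewrite integral_cell//; last by move=> ?; exact: poweR_ge0.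
rewrite muleA -EFinM powRB ?(gt_eqF t0) ?implybT//.
rewrite (powR_mulrn _ (ltW t0)) mulfVK ?gt_eqF ?exprn_gt0//.
rewrite -ge0_integralZl//; last 4 first.
- exact: measurable_unit_ball.
- apply: measurable_funTS.
  exact: (measurableT_comp mPq (@measurable_homothety _ _ x t)).
- by move=> ? _; exact: poweR_ge0.
- by rewrite lee_fin powR_ge0.
rewrite le_eqVlt; apply/orP; left; apply/eqP; apply: eq_integral => u _.
by rewrite poweRM ?lee_fin ?(ltW t0)// poweR_EFin.
Qed.

End segment_gradient.

(** * Upper gradients along segments *)

Section segment_curve.
Context {R : realType} {n : nat}.
Local Notation V := (borel_rV R n).
Local Notation mu := (lebesgue_rV R n).
Local Notation B := (@unit_ball R n).
Implicit Types (a b : 'rV[R]_n) (s t : R).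

Definition segment_curve a b : curve R n := Curve 0 1 (fun s => homothety a s b).

Lemma path_length_segment a b t : 0 <= t ->
  path_length 0 t (fun s => homothety a s b) = (t * enorm (b - a))%:E.
Proof.
move=> t0; rewrite /path_length.
have sumE (s : seq R) : itv_partition 0 t s ->
    \sum_(0 <= k < size s) enorm (homothety a (nth t (0 :: s) k.+1) b -
      homothety a (nth t (0 :: s) k) b) = t * enorm (b - a).
  move=> [/(pathP t) ps /eqP ls].
  rewrite (eq_big_nat _ _ (F2 := fun k => (nth t (0 :: s) k.+1 - nth t (0 :: s) k) *
      enorm (b - a))); last first.
    move=> k /andP[_ ks]; have := ps k ks => /= lt.
    have -> : homothety a (nth t s k) b - homothety a (nth t (0 :: s) k) b =
        (nth t s k - nth t (0 :: s) k) *: (b - a).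
      by apply/rowP => i; rewrite /homothety !mxE; ring.
    by rewrite enormZ gtr0_norm// subr_gt0.
  rewrite -mulr_suml telescope_sumr//= subr0; congr (_ * _).
  by rewrite -[size s]/(size (0 :: s)).-1 nth_last.
apply/eqP; rewrite eq_le; apply/andP; split.
  by apply: ge_ereal_sup => _ [s ps <-]; rewrite sumE.
(* Partitions are strictly increasing, so for t = 0 the list [[:: t]] is not one and the empty
   partition must be used. *)
have [t00|tn0] := eqVneq t 0.
  by apply: ereal_sup_ubound; exists [::]; [rewrite t00|rewrite sumE// t00].
apply: ereal_sup_ubound; exists [:: t].
  by split => //=; rewrite andbT lt_neqAle eq_sym tn0.
by rewrite sumE//; split => //=; rewrite andbT lt_neqAle eq_sym tn0.
Qed.

Lemma curve_length_segment a b :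
  curve_length (segment_curve a b) = (enorm (b - a))%:E.
Proof. by rewrite /curve_length/= path_length_segment// mul1r. Qed.

Lemma rectifiable_segment_curve a b : B a -> B b ->
  rectifiable_curve B (segment_curve a b).
Proof.
move=> Ba Bb; split => //=.
- have : continuous (fun s : R => a + s *: (b - a)).
    move=> s; apply: (@continuousD _ _ R^o (fun=> a) (fun s => s *: (b - a))).
      exact: cst_continuous.
    exact: scalel_continuous.
  exact: continuous_subspaceT.
- by move=> _ [s /= s01 <-]; apply: unit_ball_convex => //; rewrite in_itv/= in s01.
- by rewrite curve_length_segment ltry.
Qed.

(** The length up to time t is t |b - a|, so for distinct endpoints the parameter picked by [xget]
    is unique. *)
Lemma arclength_path_segment a b l : 0 < enorm (b - a) ->
  0 <= l <= enorm (b - a) ->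
  arclength_path (segment_curve a b) l = homothety a (l / enorm (b - a)) b.
Proof.
move=> L0 /andP[l0 lL]; rewrite /arclength_path/=; congr (homothety a _ b).
have lt : [set t | 0 <= t <= 1 /\
    path_length 0 t (fun s => homothety a s b) = l%:E] (l / enorm (b - a)).
  have lL0 : 0 <= l / enorm (b - a) by rewrite divr_ge0// ltW.
  split; first by rewrite lL0/= ler_pdivrMr// mul1r.
  by rewrite path_length_segment// divfK// gt_eqF.
apply: xget_unique => // t [/andP[t0 t1]].
by rewrite path_length_segment// => -[<-]; rewrite mulfK// gt_eqF.
Qed.

Local Open Scope ereal_scope.

(** Arc length is |b - a| times the parameter, and the substitution produces this factor. When a = b
    both sides vanish, the left one being an integral over a single point. *)
Lemma line_integral_segment a b (g : V -> \bar R) : B a -> B b ->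
  measurable_fun setT (g \_ (B : set V)) -> (forall x, B x -> 0 <= g x) ->
  line_integral (segment_curve a b) g =
  (enorm (b - a))%:E *
  \int[@lebesgue_measure R]_(s in `]0%R, 1%R])
    (g \_ (B : set V)) (homothety a s b).
Proof.
move=> Ba Bb mg g0; rewrite /line_integral curve_length_segment [fine _]/=.
have := enorm_ge0 (b - a); rewrite le_eqVlt => /predU1P[<-|L0].
  by rewrite mul0e set_itv1 integral_set1.
set L := enorm (b - a) in L0 *.
pose G (s : measurableTypeR R) := (g \_ (B : set V)) (homothety a s b).
have mG : measurable_fun setT G by exact: measurable_segment.
have gB0 (y : V) : 0 <= (g \_ (B : set V)) y by exact: erestrict_ge0.
transitivity (\int[@lebesgue_measure R]_(l in `[0%R, L]) G (l / L)%R).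
  apply: eq_integral => l lI.
  have /andP[l0 lL] : (0 <= l <= L)%R by move: lI; rewrite inE/= in_itv.
  rewrite arclength_path_segment ?l0// -/L /G patchE mem_set//.
  apply: unit_ball_convex => //.
  by rewrite divr_ge0 ?(ltW L0)//= ler_pdivrMr// mul1r.
pose H (l : measurableTypeR R) :=
  ((fun l : measurableTypeR R => G (l / L)%R) \_ `[0%R, L]%classic) l.
have mH : measurable_fun setT H.
  apply/(measurable_restrictT _ (measurable_itv `[0%R, L])).
  apply: measurable_funTS; apply: measurableT_comp => //.
  by apply: measurable_funM => //; exact: measurable_cst.
have H0 l : 0 <= H l by apply: erestrict_ge0 => ? _; exact: gB0.
rewrite integral_mkcond (ge0_integral_affine 0 L0 mH H0); congr (_ * _).
rewrite integral_itv_obnd_cbnd; last by exact: (measurable_funTS mG).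
rewrite [RHS]integral_mkcond; apply: eq_integral => s _.
rewrite /H !patchE add0r mulrAC mulfV ?gt_eqF// mul1r -/(G s).
suff -> : ((L * s)%R \in `[0%R, L]%classic) = (s \in `[0%R, 1%R]%classic) by [].
by apply/idP/idP; rewrite !inE/= !in_itv/= pmulr_rge0// -ler_pdivlMl// mulVf// gt_eqF.
Qed.

End segment_curve.

Section sobolev_gradient.
Context {R : realType} {n : nat} {X : metricType R}.
Local Notation V := (borel_rV R n).
Local Notation mu := (lebesgue_rV R n).
Local Notation B := (@unit_ball R n).
Local Open Scope ereal_scope.

(* On the ball L^oo is contained in L^(n+1); only p = +oo meets the default. *)
Definition finite_exponent (p : \bar R) : R :=
  if p is r%:E then r else n.+1%:R.

Lemma lt_finite_exponent (p : \bar R) : n%:R%:E < p ->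
  (n%:R < finite_exponent p)%R.
Proof. by case: p => [r||//]; [rewrite lte_fin|rewrite ltr_nat]. Qed.

Lemma Lp_norm_integral_lty (p : \bar R) (g : V -> \bar R) : n%:R%:E < p ->
  borel_nneg B g -> Lp_norm B p g < +oo ->
  \int[mu]_(y in B) g y `^ finite_exponent p < +oo.
Proof.
move=> np [mg g0]; have mB : measurable (B : set V) := measurable_unit_ball.
have mgB : measurable_fun setT (g \_ (B : set V)).
  by apply/(measurable_restrictT _ mB).
have q0 := le_lt_trans (ler0n R n) (lt_finite_exponent np).
rewrite /Lp_norm; case: p np q0 => [r nr r0||//].
  move=> /(@poweR_lty _ _ r); rewrite poweR_Lnorm ?gt_eqF//.
  rewrite [in X in _ -> X]integral_mkcond; apply: le_lt_trans.
  rewrite le_eqVlt; apply/orP; left; apply/eqP; apply: eq_integral => y _.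
  rewrite !patchE; case: ifPn => [|_]; last by rewrite abse0 poweR0r// gt_eqF.
  by rewrite inE => /g0 gy; rewrite gee0_abs.
move=> _ /= q0; rewrite unlock.
(* At p = +oo the norm unfolds to an essential supremum only when the whole space has positive
   measure. *)
have muT : 0 < mu setT.
  apply: (lt_le_trans (@unit_ball_measure_gt0 R n)).
  by apply: le_measure; rewrite ?inE.
rewrite muT => supoo.
set S := ess_sup mu _ in supoo.
have S0 : 0 <= S.
  rewrite /S; have := Lnorm_ge0 mu +oo (g \_ (B : set V)).
  by rewrite unlock muT.
have SE : S = (fine S)%:E by rewrite fineK// ge0_fin_numE.
apply: (@le_lt_trans _ _ (\int[mu]_(y in B) (fine S `^ n.+1%:R)%:E)).
  apply: ae_ge0_le_integral => //.
  - by move=> y _; exact: poweR_ge0.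
  - exact: (measurableT_comp (measurable_poweR _) mg).
  - by move=> y _; rewrite lee_fin powR_ge0.
  - have := ess_sup_ge mu (abse \o (g \_ (B : set V))).
    apply: filterS => y; rewrite -/S SE /= patchE => h By.
    move: h; rewrite mem_set// gee0_abs ?g0// => h.
    rewrite -poweR_EFin; apply: gt0_ler_poweR => //.
    + by rewrite in_itv/= g0// leey.
    + by rewrite in_itv/= leey -SE S0.
rewrite integral_cst//= lte_mul_pinfty ?lee_fin ?powR_ge0//.
exact: unit_ball_measure_lty.
Qed.

Lemma poweR_maxe_le (q : R) (a b : \bar R) : 0 <= a -> 0 <= b ->
  maxe a b `^ q <= a `^ q + b `^ q.
Proof.
move=> a0 b0; have [ab|ab] := leP a b.
  by rewrite leeDr// poweR_ge0.
by rewrite leeDl// poweR_ge0.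
Qed.

Lemma sobolev_segment_gradient (W : completeNormedModType R) (iota : X -> W)
    (p : \bar R) (f : 'rV[R]_n -> X) (D : R) : n%:R%:E < p ->
  newton_sobolev iota B p f ->
  (forall x y, B x -> B y -> (mdist (f x) (f y) <= D)%R) ->
  exists P : V -> \bar R, segment_gradient f P /\
    \int[mu]_(y in B) P y `^ finite_exponent p < +oo.
Proof.
move=> np [_ [rho [[mrho rho0] rhoL [G [G0 aeG]]]]] fD.
have mB : measurable (B : set V) := measurable_unit_ball.
have D0 : (0 <= D)%R.
  exact: le_trans (mdist_ge0 _ _) (fD _ _ unit_ball0 unit_ball0).
have q0 := le_lt_trans (ler0n R n) (lt_finite_exponent np).
set q := finite_exponent p in q0 *.
(* Only the finiteness of the modulus is used: the diameter bound D times an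
   admissible g is an upper gradient along the exceptional curves. *)
have [g [[mg g0] gG] gL] : exists2 g, borel_nneg B g /\
    (forall c, G c -> rectifiable_curve B c -> 1 <= line_integral c g) &
    Lp_norm B p g < +oo.
  have : modulus B p G < +oo by rewrite G0 ltry.
  move=> /ereal_inf_lt[_ [g [gB gG] <-]] gL; exists g; first by split.
  move: gL np; case: (p) => [r gL|//|//]; rewrite lte_fin => nr.
  by apply: lty_poweRy gL; rewrite gt_eqF// (le_lt_trans _ nr).
have mrB : measurable_fun setT (rho \_ (B : set V)) by apply/(measurable_restrictT _ mB).
have mgB : measurable_fun setT (g \_ (B : set V)) by apply/(measurable_restrictT _ mB).
have rB0 (y : V) : 0 <= (rho \_ (B : set V)) y by exact: erestrict_ge0.
have gB0 (y : V) : 0 <= (g \_ (B : set V)) y by exact: erestrict_ge0.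
(* The maximum dominates both gradients, and its q-th power is at most the sum of the q-th powers,
   without any constant. *)
pose P (y : V) := maxe ((rho \_ (B : set V)) y) (D%:E * (g \_ (B : set V)) y).
have mDg : measurable_fun setT (fun y : V => D%:E * (g \_ (B : set V)) y).
  by apply: emeasurable_funM => //; exact: measurable_cst.
have Dg0 y : 0 <= D%:E * (g \_ (B : set V)) y by rewrite mule_ge0.
have mP : measurable_fun setT P by exact: measurable_maxe.
have P0 y : 0 <= P y by rewrite le_max rB0.
exists P; split; first split => //.
  move=> a b Ba Bb; have rab := rectifiable_segment_curve Ba Bb.
  have L0 : 0 <= (enorm (b - a))%:E by rewrite lee_fin enorm_ge0.
  have [Gc|nGc] := pselect (G (segment_curve a b)).
    have := gG _ Gc rab; rewrite line_integral_segment// => ge1.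
    apply: (@le_trans _ _ (D%:E * 1)); first by rewrite mule1 lee_fin fD.
    apply: (le_trans (lee_wpmul2l _ ge1)); first by rewrite lee_fin.
    rewrite muleCA lee_wpmul2l// -ge0_integralZl//; last first.
      by apply: measurable_funTS; exact: measurable_segment.
    apply: ge0_le_integral => //.
    - apply: measurable_funTS.
      exact: (measurable_segment _ _ mDg).
    - by apply: measurable_funTS; exact: measurable_segment.
    - by move=> s _; rewrite le_max lexx orbT.
  have := aeG _ rab nGc; rewrite line_integral_segment// /= => h.
  have hom0 : homothety a 0 b = a by rewrite /homothety scale0r addr0.
  have hom1 : homothety a 1 b = b by rewrite /homothety scale1r subrKC.
  rewrite hom0 hom1 in h; apply: (le_trans h).
  rewrite lee_wpmul2l//; apply: ge0_le_integral => //.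
  - by apply: measurable_funTS; exact: measurable_segment.
  - by apply: measurable_funTS; exact: measurable_segment.
  - by move=> s _; rewrite le_max lexx.
have mrq : measurable_fun (B : set V) (fun y : V => rho y `^ q).
  exact: (measurableT_comp (measurable_poweR _) mrho).
have mgq : measurable_fun (B : set V) (fun y : V => g y `^ q).
  exact: (measurableT_comp (measurable_poweR _) mg).
apply: (@le_lt_trans _ _ (\int[mu]_(y in B)
    (rho y `^ q + (D `^ q)%:E * g y `^ q))).
  apply: ge0_le_integral => //.
  - by move=> y _; exact: poweR_ge0.
  - by apply: measurable_funTS; exact: measurable_poweR_comp.
  - apply: emeasurable_funD => //.
    by apply: emeasurable_funM => //; exact: measurable_cst.
  - move=> y By; rewrite /P !patchE mem_set//.
    apply: (le_trans (poweR_maxe_le _ _ _)); first exact: rho0.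
      by rewrite mule_ge0// g0.
    by rewrite poweRM ?g0// poweR_EFin.
rewrite ge0_integralD//; last 3 first.
- by move=> y _; exact: poweR_ge0.
- by move=> y _; rewrite mule_ge0 ?poweR_ge0// lee_fin powR_ge0.
- by apply: emeasurable_funM => //; exact: measurable_cst.
rewrite ge0_integralZl//; last 2 first.
- by move=> y _; exact: poweR_ge0.
- by rewrite lee_fin powR_ge0.
apply: lte_add_pinfty; first exact: Lp_norm_integral_lty.
rewrite lte_mul_pinfty ?lee_fin ?powR_ge0//.
exact: Lp_norm_integral_lty.
Qed.

End sobolev_gradient.

(** * Oscillation on cells and packing *)

Section cell_oscillation.
Context {R : realType} {n : nat} {X : metricType R}.
Local Notation V := (borel_rV R n).
Local Notation mu := (lebesgue_rV R n).
Local Notation B := (@unit_ball R n).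
Context (f : 'rV[R]_n -> X) (P : V -> \bar R) (q : R).
Context (n_gt0 : (0 < n)%N) (nq : n%:R < q).
Context (sgP : segment_gradient f P).
Context (Poo : (\int[mu]_(y in B) P y `^ q < +oo)%E).
Let C := @morrey_constant R n q.

Let C0 : 0 < C. Proof. exact: morrey_constant_gt0. Qed.

Let mP : measurable_fun setT P. Proof. by case: sgP. Qed.

Let P0 y : (0 <= P y)%E. Proof. by case: sgP. Qed.

Let mPq : measurable_fun setT (fun y : V => P y `^ q)%E.
Proof. exact: measurable_poweR_comp. Qed.

Let Pq0 y : (0 <= P y `^ q)%E. Proof. exact: poweR_ge0. Qed.

Lemma integral_cell_poweR_fin x t : 0 < t <= 1 -> B x ->
  (\int[mu]_(y in cell x t) P y `^ q)%E \is a fin_num.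
Proof.
move=> t01 Bx; rewrite ge0_fin_numE; last exact: integral_ge0.
exact: le_lt_trans (ge0_subset_cell t01 Bx mPq Pq0) Poo.
Qed.

(** The weight t^(q - n) tends to 0 with [t] while the integral of P^q over a cell is at most its
    integral over the ball, so the Morrey bound is small uniformly in [x]. *)
Lemma cell_small_oscillation (e : R) : 0 < e -> exists2 d, 0 < d <= 1 &
  forall x t y z, B x -> 0 < t <= d -> cell x t y -> cell x t z ->
  mdist (f y) (f z) <= e.
Proof.
move=> e0; pose J := fine (\int[mu]_(y in B) P y `^ q)%E.
have J0 : 0 <= J by apply: fine_ge0; apply: integral_ge0.
have qn0 : 0 < q - n%:R by rewrite subr_gt0.
pose L := e / C; have L0 : 0 < L by rewrite divr_gt0.
(* This is the bound to impose on t^(q - n), since u J <= L^q; adding 1 avoids a division by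
   zero. *)
pose u := L `^ q / (J + 1).
have u0 : 0 < u by rewrite divr_gt0 ?powR_gt0// ltr_wpDl.
exists (Num.min 1 (u `^ (q - n%:R)^-1)).
  by rewrite lt_min ltr01 powR_gt0//= ge_min lexx.
move=> x t y z Bx /andP[t0]; rewrite le_min => /andP[t1 tu] cy cz.
have t01 : 0 < t <= 1 by rewrite t0.
have -> : e = C * L by rewrite /L mulrC divfK// gt_eqF.
apply: (morrey_cell n_gt0 nq sgP Bx t01 L0 _ cy cz).
apply: (@le_trans _ _ (u%:E * J%:E)%E).
  apply: lee_pmul => //; rewrite ?lee_fin ?powR_ge0//; first exact: integral_ge0.
    have := @ge0_ler_powR _ (q - n%:R) (ltW qn0) t (u `^ (q - n%:R)^-1).
    rewrite !nnegrE powR_ge0 (ltW t0) => /(_ isT isT tu) /le_trans; apply.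
    by rewrite -powRrM mulVf ?gt_eqF// powRr1// ltW.
  rewrite /J fineK; first exact: ge0_subset_cell.
  by rewrite ge0_fin_numE//; exact: integral_ge0.
rewrite -EFinM lee_fin /u -mulrA ler_piMr ?powR_ge0// mulrC.
by rewrite ler_pdivrMr ?mul1r ?lerDl// ltr_wpDl.
Qed.

(** [cell y t] is the closed Euclidean ball of centre (1 - t) y and radius [t]. The common point is
    the midpoint of the two centres, at distance at most (1 - t) t from each. *)
Lemma cell_midpoint (y z : 'rV[R]_n) t : 0 < t <= 1 ->
  enorm (z - y) <= 2 * t ->
  exists w, cell y t w /\ cell z t w.
Proof.
move=> /andP[t0 t1] yz; exists ((1 - t) / 2 *: (y + z)).
have Bb (s : R) : `|s| = (1 - t) / (2 * t) -> B (s *: (z - y)).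
  move=> sE; rewrite /unit_ball/= enormZ sE.
  apply: (@le_trans _ _ ((1 - t) / (2 * t) * (2 * t))).
    by rewrite ler_wpM2l// divr_ge0 ?subr_ge0// mulr_ge0// ltW.
  by rewrite divfK ?gt_eqF ?mulr_gt0// gerBl ltW.
have k0 : 0 <= (1 - t) / (2 * t) by rewrite divr_ge0 ?subr_ge0// mulr_ge0// ltW.
split.
  exists ((1 - t) / (2 * t) *: (z - y)); first by apply: Bb; rewrite ger0_norm.
  by apply/rowP => i; rewrite /homothety !mxE; field; rewrite gt_eqF.
exists (- ((1 - t) / (2 * t)) *: (z - y)).
  by apply: Bb; rewrite normrN ger0_norm.
by apply/rowP => i; rewrite /homothety !mxE; field; rewrite gt_eqF.
Qed.

(** The ratios j/N are tried in increasing order until the image of a cell leaves the ball of radius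
    r/2 around f x. One step earlier it was still inside, and a step moves image points by at most
    r/2, so the image stays within [r]. If no ratio up to 1 is reached, t = 1 works. *)
Lemma exit_cell x (r : R) : B x -> 0 < r -> exists2 t, 0 < t <= 1 &
  (forall z, cell x t z -> mdist (f x) (f z) <= r) /\
  (t = 1 \/ exists2 z, cell x t z & r / 2 <= mdist (f x) (f z)).
Proof.
move=> Bx r0; have r40 : 0 < r / 4 by rewrite divr_gt0.
have [d /andP[d0 d1] osc] := cell_small_oscillation r40.
pose N := (Num.truncn d^-1).+1.
have N0 : 0 < N%:R :> R by rewrite ltr0n.
have Nd : N%:R^-1 < d.
  by rewrite -[ltRHS]invrK ltf_pV2 ?posrE ?invr_gt0// truncnS_gt.
(* Uniform continuity from the oscillation bound: the cells of ratio [d] around y and z share a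
   point, and each contributes r/4. *)
have unif y z : B y -> B z -> enorm (z - y) <= 2 * d -> mdist (f y) (f z) <= r / 2.
  move=> By Bz yz; have d01 : 0 < d <= 1 by rewrite d0.
  have dd : 0 < d <= d by rewrite d0/=.
  have [w [yw zw]] := cell_midpoint d01 yz.
  apply: (le_trans (metric_triangle _ (f w) _)).
  rewrite [leRHS](_ : _ = r / 4 + r / 4); last by field.
  apply: lerD; first by apply: (osc y d) => //; exact: cell_center.
  by apply: (osc z d) => //; exact: cell_center.
pose far j := `[< exists2 z, cell x (j%:R / N%:R) z & r / 2 < mdist (f x) (f z) >].
have near_le j z : ~~ far j -> cell x (j%:R / N%:R) z -> mdist (f x) (f z) <= r / 2.
  move=> /asboolPn nf cz; rewrite leNgt; apply/negP => h; apply: nf.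
  by exists z.
have [[j jN fj]|nofar] := pselect (exists2 j, (j <= N)%N & far j); last first.
  exists 1; first by rewrite ltr01 lexx.
  split; last by left.
  move=> z cz; apply: (@le_trans _ _ (r / 2)); last by lra.
  apply: (near_le N); last by rewrite divff// gt_eqF.
  by apply/negP => fN; apply: nofar; exists N.
have exfar : exists j, far j by exists j.
pose k := ex_minn exfar.
have [fk kmin] : far k /\ forall i, far i -> (k <= i)%N.
  by rewrite /k; case: ex_minnP.
have kN : (k <= N)%N by exact: leq_trans (kmin _ fj) jN.
(* The cell of ratio 0 is reduced to [x], so it is not far and a previous ratio exists. *)
have k0 : (0 < k)%N.
  rewrite lt0n; apply/negP => /eqP k0; move: fk; rewrite k0 => /asboolP[z].
  rewrite mul0r => -[b _ <-]; rewrite /homothety scale0r addr0 mdistxx.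
  by rewrite ltNge divr_ge0// ltW.
exists (k%:R / N%:R).
  by rewrite divr_gt0 ?ltr0n//= ler_pdivrMr// mul1r ler_nat.
split; last first.
  by right; move/asboolP : fk => [z cz rz]; exists z => //; exact: ltW.
move=> _ [b Bb <-]; set z := homothety _ _ _.
pose z' := homothety x (k.-1%:R / N%:R) b.
have kk : (k.-1 < k)%N by rewrite prednK.
have d1' : mdist (f x) (f z') <= r / 2.
  apply: (near_le k.-1); last by exists b.
  by apply/negP => /kmin; rewrite leqNgt kk.
have cellB i : (i <= N)%N -> B (homothety x (i%:R / N%:R) b).
  move=> iN; apply: unit_ball_convex => //.
  by rewrite divr_ge0//= ler_pdivrMr// mul1r ler_nat.
have d2' : mdist (f z') (f z) <= r / 2.
  apply: unif.
  - by apply: cellB; rewrite (leq_trans (leq_pred _)).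
  - exact: cellB.
  - have -> : z - z' = N%:R^-1 *: (b - x).
      apply/rowP => i; rewrite /z /z' /homothety !mxE -(prednK k0) -natr1/=.
      by field; rewrite gt_eqF.
    rewrite enormZ ger0_norm ?invr_ge0// mulrC.
    apply: ler_pM; rewrite ?enorm_ge0 ?invr_ge0 ?(ltW Nd)//.
    exact: unit_ball_enormB.
apply: (le_trans (metric_triangle _ (f z') _)).
by rewrite [leRHS](splitr r) lerD.
Qed.

Local Open Scope ereal_scope.

Let h (y : V) : \bar R := 1 + P y `^ q.

Let mh : measurable_fun setT h.
Proof. by apply: emeasurable_funD => //; exact: measurable_cst. Qed.

Let h0 y : 0 <= h y. Proof. by rewrite adde_ge0. Qed.

Let m := fine (mu B).

Let m0 : (0 < m)%R.
Proof. by rewrite fine_gt0// unit_ball_measure_gt0 unit_ball_measure_lty. Qed.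

Let muB : mu B = m%:E.
Proof. by rewrite fineK// ge0_fin_numE// unit_ball_measure_lty. Qed.

Lemma integral_cell_add1 x t : (0 < t <= 1)%R -> B x ->
  \int[mu]_(y in cell x t) h y =
  (t ^+ n * m + fine (\int[mu]_(y in cell x t) P y `^ q))%:E.
Proof.
move=> t01 Bx; have /andP[t0 _] := t01.
have mC : measurable (cell x t : set V) by apply: measurable_cell; rewrite gt_eqF.
rewrite /h ge0_integralD//; last exact: measurable_funTS.
rewrite integral_cst// mul1e measure_cell// muB -EFinM EFinD fineK//.
exact: integral_cell_poweR_fin.
Qed.

(** The term (2 C)^n serves cells on which f moves by at least r/2, the term D^n those with t = 1.
    Dividing by min(1, m) makes the quotient dominate both t^n and the integral of P^q over the
    cell. *)
Definition packing_constant (D : R) : R :=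
  (((2 * C) ^+ n + D ^+ n) / Num.min 1 m)%R.

Lemma packing_cell (D r : R) x : B x -> (0 < r <= D)%R ->
  exists2 t, (0 < t <= 1)%R &
  (forall z, cell x t z -> (mdist (f x) (f z) <= r)%R) /\
  (r ^+ n)%:E <= (packing_constant D)%:E * \int[mu]_(y in cell x t) h y.
Proof.
move=> Bx /andP[r0 rD]; have [t t01 [cr rt]] := exit_cell Bx r0.
exists t => //; split=> //; have /andP[t0 t1] := t01.
rewrite integral_cell_add1// -EFinM lee_fin.
set J := fine _; set m1 := Num.min 1%R m.
have J0 : (0 <= J)%R by apply: fine_ge0; exact: integral_ge0.
have m10 : (0 < m1)%R by rewrite lt_min ltr01.
have tn0 : (0 < t ^+ n)%R by rewrite exprn_gt0.
rewrite /packing_constant mulrAC -mulrA -/m1.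
set v := ((t ^+ n * m + J) / m1)%R.
have tv : (t ^+ n <= v)%R.
  rewrite ler_pdivlMr// (le_trans (ler_wpM2l (ltW tn0) (_ : m1 <= m)%R))//.
    by rewrite ge_min lexx orbT.
  by rewrite lerDl.
have Jv : (J <= v)%R.
  rewrite ler_pdivlMr// (le_trans (ler_wpM2l J0 (_ : m1 <= 1)%R))//.
    by rewrite ge_min lexx.
  by rewrite mulr1 lerDr mulr_ge0 ?(ltW m0)// ltW.
have v0 : (0 < v)%R by rewrite (lt_le_trans tn0).
have n0 : (0 < n%:R :> R)%R by rewrite ltr0n.
(* Chosen so that L^n = v: then t <= L and L^q = L^(q - n) v dominates t^(q - n) J, which is the
   hypothesis of the Morrey estimate. *)
pose L := (v `^ n%:R^-1)%R.
have L0 : (0 < L)%R by rewrite powR_gt0.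
have Ln : (L ^+ n = v)%R.
  by rewrite -powR_mulrn ?(ltW L0)// -powRrM mulVf ?gt_eqF// powRr1// ltW.
have tL : (t <= L)%R.
  by rewrite -(@ler_pXn2r _ n)// ?nnegrE ?(ltW t0) ?(ltW L0)// Ln.
have rn := ltW r0.
rewrite mulrDl; case: rt => [t1E|[z cz rz]].
  apply: ler_wpDl.
    by apply: mulr_ge0 (ltW v0); apply: exprn_ge0; apply: mulr_ge0 (ltW C0).
  apply: (@le_trans _ _ (D ^+ n * 1)%R).
    by rewrite mulr1 lerXn2r// nnegrE// (le_trans rn).
  apply: ler_wpM2l; first by rewrite exprn_ge0// (le_trans rn).
  by rewrite (le_trans _ tv)// t1E expr1n.
apply: ler_wpDr.
  by apply: mulr_ge0 (ltW v0); apply: exprn_ge0; exact: le_trans rn rD.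
have rL : (r <= 2 * C * L)%R.
  rewrite -mulrA mulrC -ler_pdivrMr//; apply: (le_trans rz).
  apply: (morrey_cell n_gt0 nq sgP Bx t01 L0 _ (cell_center t Bx) cz).
  rewrite -[X in _ * X]fineK; last exact: integral_cell_poweR_fin.
  rewrite -EFinM lee_fin -/J.
  have -> : (L `^ q = L `^ (q - n%:R) * v)%R.
    rewrite -Ln -powR_mulrn ?(ltW L0)// -powRD ?subrK//.
    by rewrite (gt_eqF L0) implybT.
  apply: ler_pM; rewrite ?powR_ge0//.
  by apply: ge0_ler_powR; rewrite ?nnegrE ?subr_ge0 ?(ltW t0) ?(ltW L0)// ltW.
by rewrite -Ln -exprMn lerXn2r// nnegrE// mulr_ge0 ?(ltW L0)// mulr_ge0// ltW.
Qed.

Lemma esum_cells_le (I : set nat) (x : nat -> 'rV[R]_n) (t : nat -> R)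
    (g : V -> \bar R) :
  measurable_fun setT g -> (forall y, 0 <= g y) ->
  (forall i, I i -> B (x i) /\ (0 < t i <= 1)%R) ->
  trivIset I (fun i => cell (x i) (t i)) ->
  \esum_(i in I) \int[mu]_(y in cell (x i) (t i)) g y <=
  \int[mu]_(y in B) g y.
Proof.
move=> mg g0 xt tI; rewrite esum_mkcond.
pose F i : set V := if i \in I then cell (x i) (t i) else set0.
have mF i : measurable (F i).
  rewrite /F; case: ifPn => // /set_mem /xt[_ /andP[t0 _]].
  by apply: measurable_cell; rewrite gt_eqF.
have mUF : measurable (\bigcup_i F i) by exact: bigcupT_measurable.
have tF : trivIset setT F.
  apply/trivIsetP => i j _ _ ij; rewrite /F.
  case: ifPn => [/set_mem Ii|_]; last by rewrite set0I.
  case: ifPn => [/set_mem Ij|_]; last by rewrite setI0.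
  by move/trivIsetP : tI; exact.
rewrite (eq_esum (b := fun i => \int[mu]_(y in F i) g y)); last first.
  by move=> i _; rewrite /F; case: ifPn => // _; rewrite integral_set0.
rewrite -nneseries_esumT; last by move=> i; exact: integral_ge0.
rewrite -ge0_integral_bigcup//; last exact: measurable_funTS.
apply: ge0_subset_integral => //.
- exact: measurable_unit_ball.
- exact: measurable_funTS.
- move=> y [i _]; rewrite /F; case: ifPn => // /set_mem /xt[Bx /andP[t0 t1]].
  by apply: cell_sub => //; rewrite ltW.
Qed.

(** The separation hypothesis says that the balls have disjoint preimages in B. The cells given by
    [packing_cell] lie in these preimages, so their bounds add up to an integral over B. *)
Lemma packing_sum_le (D : R) (D0 : (0 <= D)%R) (I : set nat) (x : nat -> 'rV[R]_n) (r : nat -> R) :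
  (forall i, I i -> B (x i) /\ (0 < r i <= D)%R) ->
  (forall i j z, I i -> I j -> B z -> (mdist (f (x i)) (f z) <= r i)%R ->
     (mdist (f (x j)) (f z) <= r j)%R -> i = j) ->
  \esum_(i in I) ((r i)%:E `^ n%:R) <=
  (packing_constant D)%:E * \int[mu]_(y in B) h y.
Proof.
move=> xr sep.
have ex i : exists t, I i -> (0 < t <= 1)%R /\
   ((forall z, cell (x i) t z -> (mdist (f (x i)) (f z) <= r i)%R) /\
   (r i ^+ n)%:E <= (packing_constant D)%:E * \int[mu]_(y in cell (x i) t) h y).
  have [Ii|nIi] := pselect (I i); last by exists 0%R.
  by have [Bx rD] := xr i Ii; have [t t01 tP] := packing_cell Bx rD; exists t.
pose t i := sval (cid (ex i)); have tP i : I i -> _ := svalP (cid (ex i)).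
have K0 : (0 <= packing_constant D)%R.
  rewrite divr_ge0 ?le_min ?ler01 ?(ltW m0)//.
  apply: addr_ge0; last exact: exprn_ge0.
  by apply: exprn_ge0; apply: mulr_ge0 (ltW C0).
have mKh : measurable_fun setT (fun y => (packing_constant D)%:E * h y).
  by apply: emeasurable_funM => //; exact: measurable_cst.
have Kh0 y : 0 <= (packing_constant D)%:E * h y by rewrite mule_ge0.
have mB : measurable (B : set V) := measurable_unit_ball.
rewrite -ge0_integralZl//; last exact: measurable_funTS.
apply: le_trans (esum_cells_le mKh Kh0 (x := x) (t := t) (I := I) _ _).
- apply: le_esum => i Ii; have [Bx /andP[r0 _]] := xr i Ii.
  have [/andP[t0 _] [_]] := tP i Ii.
  rewrite poweR_EFin powR_mulrn ?(ltW r0)// ge0_integralZl//.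
    by apply: measurable_cell; rewrite gt_eqF.
  exact: measurable_funTS.
- by move=> i Ii; have [Bx _] := xr i Ii; have [] := tP i Ii.
- apply/trivIsetP => i j Ii Ij; apply: contra_neqP => /eqP/set0P[z [zi zj]].
  have [Bi _] := xr i Ii; have [ti [ri _]] := tP i Ii.
  have [tj [rj _]] := tP j Ij.
  apply: (sep i j z) => //; [|exact: ri|exact: rj].
  by apply: cell_sub zi => //; have /andP[/ltW -> ->] := ti.
Qed.

End cell_oscillation.

(** * Covering of the steep points *)

(** Vitali's covering argument for an abstract intersection relation. Below, T consists of points of
    the domain and [meet] compares the distance of their images with the sum of the radii. *)
Lemma vitali_selection {R : realType} (T : Type) (A : set T) (r : T -> R)
    (meet : T -> T -> Prop) (M : R) :
  (forall i, A i -> 0 < r i <= M) -> (forall i, A i -> meet i i) ->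
  (forall i j, meet i j -> meet j i) ->
  exists S : set T, [/\ S `<=` A, forall i j, S i -> S j -> meet i j -> i = j &
    forall j, A j -> exists2 s, S s & meet j s /\ r j <= 2 * r s].
Proof.
move=> rM refl_meet sym_meet.
(* A maximal S with property Q meets everything in A: otherwise an element of
   nearly maximal radius among those meeting no element of S could be added. *)
pose Q (S : set T) := [/\ S `<=` A, forall i j, S i -> S j -> meet i j -> i = j &
  forall j, A j -> (exists2 s, S s & meet j s) ->
    exists2 s, S s & meet j s /\ r j <= 2 * r s].
have [F FQ Ftot|S [[SA Ssep SQ] Smax]] := @Zorn_bigcup T Q.
  split.
  - by move=> i [S /FQ[SA _ _] Si]; exact: SA.
  - move=> i j [S FS Si] [S' FS' S'j] ij.
    have [SS'|S'S] := Ftot _ _ FS FS'.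
      by have [_ sep _] := FQ _ FS'; apply: sep => //; exact: SS'.
    by have [_ sep _] := FQ _ FS; apply: sep => //; exact: S'S.
  - move=> j Aj [s [S FS Ss] js]; have [_ _ SQ] := FQ _ FS.
    have [|s' Ss' js'] := SQ j Aj; first by exists s.
    by exists s' => //; exists S.
exists S; split => // j Aj; apply: (SQ) => //; apply: contrapT => Nj.
pose A' := [set i | A i /\ ~ exists2 s, S s & meet i s].
have A'sup : has_sup (r @` A').
  split; first by exists (r j), j.
  by exists M => _ [i [Ai _] <-]; have /andP[] := rM i Ai.
set rho := sup (r @` A').
have ler_rho i : A' i -> r i <= rho by move=> A'i; apply: ub_le_sup; [case: A'sup|exists i].
have rho0 : 0 < rho.
  by apply: lt_le_trans (ler_rho j _) => //; have /andP[] := rM j Aj.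
have rho20 : 0 < rho / 2 by rewrite divr_gt0.
have [_ [i [Ai Ni] <-] ri] := sup_adherent rho20 A'sup.
have {}ri : rho <= 2 * r i by rewrite -/rho in ri; lra.
have NSi : ~ S i by move=> Si; apply: Ni; exists i => //; exact: refl_meet.
apply: (Smax (S `|` [set i])).
  split; first by left.
  by move=> /(_ i) h; apply: NSi; apply: h; right.
split.
- by move=> k [/SA//|->].
- move=> k l [Sk|->] [Sl|->] kl //.
  + exact: Ssep.
  + by case: Ni; exists k => //; exact: sym_meet.
  + by case: Ni; exists l.
- move=> k Ak [s0 S's0 ks0].
  have [Mk|Nk] := pselect (exists2 s, S s & meet k s).
    by have [s' Ss' ks'] := SQ k Ak Mk; exists s' => //; left.
  case: S's0 => [Ss0|->{s0}] in ks0 *; first by case: Nk; exists s0.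
  by exists i; [right|split => //; apply: le_trans ri; exact: ler_rho].
Qed.

Section lipschitz_pieces.
Context {R : realType} {n : nat} {X : metricType R}.
Local Notation V := (borel_rV R n).
Local Notation mu := (lebesgue_rV R n).
Local Notation B := (@unit_ball R n).
Context (f : 'rV[R]_n -> X) (P : V -> \bar R) (q D : R).
Context (n_gt0 : (0 < n)%N) (nq : n%:R < q).
Context (sgP : segment_gradient f P).
Context (Poo : (\int[mu]_(y in B) P y `^ q < +oo)%E).
Context (fD : forall x y, B x -> B y -> mdist (f x) (f y) <= D).
Let C := @morrey_constant R n q.

Let C0 : 0 < C. Proof. exact: morrey_constant_gt0. Qed.

Let mPq : measurable_fun setT (fun y : V => P y `^ q)%E.
Proof. by case: sgP => mP _ _; exact: measurable_poweR_comp. Qed.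

Let Pq0 y : (0 <= P y `^ q)%E. Proof. exact: poweR_ge0. Qed.

Definition cell_lipschitz_set (k : R) : set 'rV[R]_n :=
  [set x | B x /\ forall t z, 0 < t <= 1 -> cell x t z ->
                  mdist (f x) (f z) <= k * t].

(** The cells of ratio t = |x - y| / 2 around x and y have a common point, and k t + k t = k |x -
    y|. *)
Lemma cell_lipschitz_set_lipschitz k x y :
  cell_lipschitz_set k x -> cell_lipschitz_set k y ->
  mdist (f x) (f y) <= k * enorm (x - y).
Proof.
move=> [Bx gx] [By gy]; have := enorm_ge0 (x - y).
rewrite le_eqVlt => /predU1P[xy0|xy0].
  have /eqP := enorm_eq0 (esym xy0); rewrite subr_eq0 => /eqP <-.
  by rewrite mdistxx subrr enorm0 mulr0.
pose t := enorm (x - y) / 2.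
have t01 : 0 < t <= 1.
  by rewrite divr_gt0//= ler_pdivrMr// mul1r unit_ball_enormB.
have [|w [yw xw]] := @cell_midpoint _ _ y x t t01.
  by rewrite /t mulrC divfK.
apply: (le_trans (metric_triangle _ (f w) _)).
have -> : enorm (x - y) = t + t by rewrite /t -splitr.
by rewrite mulrDr lerD ?(gx t)// metric_sym (gy t).
Qed.

(** Here [r] is the least radius for which the ball around f x contains the image of the cell.
    Minimality forces the hypothesis of the Morrey estimate to fail at L = r / (2 C), and t < r / k
    turns this failure into the bound on r^n. *)
Lemma steep_cell k x : 0 < k -> B x -> ~ cell_lipschitz_set k x ->
  exists t r, [/\ 0 < t <= 1, 0 < r /\ k * t <= D,
    (forall z, cell x t z -> mdist (f x) (f z) <= r),
    (forall e, (forall z, cell x t z -> mdist (f x) (f z) <= e) -> r <= e) &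
    ((r ^+ n)%:E <= ((2 * C) `^ q * k `^ (n%:R - q))%:E *
                    \int[mu]_(y in cell x t) P y `^ q)%E].
Proof.
move=> k0 Bx nG.
have [t [z [t01 cz kz]]] : exists t z, [/\ 0 < t <= 1, cell x t z &
    k * t < mdist (f x) (f z)].
  apply: contrapT => h; apply: nG; split => // t z t01 cz.
  by rewrite leNgt; apply/negP => kz; apply: h; exists t, z.
have /andP[t0 t1] := t01.
pose S := [set mdist (f x) (f z) | z in cell x t].
have cB : cell x t `<=` B by apply: cell_sub => //; rewrite ltW.
have supS : has_sup S.
  split; first by exists (mdist (f x) (f z)), z.
  by exists D => _ [y /cB By <-]; exact: fD.
pose r := sup S.
have le_r y : cell x t y -> mdist (f x) (f y) <= r.
  by move=> cy; apply: ub_le_sup; [case: supS|exists y].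
have r_le e : (forall z, cell x t z -> mdist (f x) (f z) <= e) -> r <= e.
  move=> h; apply: ge_sup; first by case: supS.
  by move=> _ [y cy <-]; exact: h.
have kr : k * t < r by exact: lt_le_trans kz (le_r _ cz).
have r0 : 0 < r by rewrite (lt_trans _ kr)// mulr_gt0.
exists t, r; split => //.
  by split=> //; rewrite (le_trans (ltW kr))// r_le// => y /cB; exact: fD.
pose I := fine (\int[mu]_(y in cell x t) P y `^ q)%E.
have IE : (\int[mu]_(y in cell x t) P y `^ q)%E = I%:E.
  have Ifin := integral_cell_poweR_fin sgP Poo t01 Bx.
  by rewrite fineK.
have I0 : 0 <= I by apply: fine_ge0; exact: integral_ge0.
rewrite IE -EFinM lee_fin.
have C20 : 0 < 2 * C by rewrite mulr_gt0.
pose L := r / (2 * C); have L0 : 0 < L by rewrite divr_gt0.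
have LI : L `^ q < t `^ (q - n%:R) * I.
  rewrite ltNge; apply/negP => IL.
  (* Otherwise the Morrey estimate would give r <= C L = r / 2. *)
  suff : r <= C * L.
    rewrite /L leNgt => /negP; apply; rewrite -subr_gt0.
    rewrite (_ : _ - _ = r / 2) ?divr_gt0//; field.
    by rewrite gt_eqF.
  apply: r_le => y cy; apply: (morrey_cell n_gt0 nq sgP Bx t01 L0 _ _ cy).
    by rewrite IE -EFinM lee_fin.
  exact: cell_center.
have qn0 : 0 <= q - n%:R by rewrite subr_ge0 ltW.
have rq : r `^ q <= (2 * C) `^ q * ((r / k) `^ (q - n%:R) * I).
  have -> : r = 2 * C * L by rewrite /L mulrC divfK// gt_eqF.
  rewrite powRM ?(ltW L0) ?(ltW C20)// ler_wpM2l ?powR_ge0//.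
  apply: (le_trans (ltW LI)); rewrite ler_wpM2r//.
  have -> : 2 * C * L = r by rewrite /L mulrC divfK// gt_eqF.
  apply: ge0_ler_powR; rewrite ?nnegrE ?(ltW t0)//.
    by rewrite divr_ge0 ?(ltW r0)// ltW.
  by rewrite ler_pdivlMr// mulrC ltW.
have -> : r ^+ n = r `^ q / r `^ (q - n%:R).
  rewrite -powR_mulrn ?(ltW r0)// -powRN -powRD; last by rewrite (gt_eqF r0) implybT.
  by congr (_ `^ _); ring.
rewrite ler_pdivrMr ?powR_gt0//; apply: (le_trans rq).
have -> : (r / k) `^ (q - n%:R) = r `^ (q - n%:R) * k `^ (n%:R - q).
  rewrite powRM ?(ltW r0) ?invr_ge0 ?(ltW k0)//; congr (_ * _).
  by rewrite -powR_inv1 ?(ltW k0)// -powRrM mulN1r opprB.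
by rewrite le_eqVlt; apply/orP; left; apply/eqP; ring.
Qed.

(** The centre (1 - t) x of the cell is approximated within t/n in each coordinate, and the squares
    sum to at most t^2. Rational points make a disjoint family of cells countable. *)
Lemma rational_in_cell (x : 'rV[R]_n) (t : R) : 0 < t -> exists v : 'rV[rat]_n,
  cell x t (map_mx ratr v).
Proof.
move=> t0; pose e := t / n%:R.
have n0 : 0 < n%:R :> R by rewrite ltr0n.
have e0 : 0 < e by rewrite divr_gt0.
have vi i : exists v : rat, `|ratr v - (1 - t) * x ord0 i| <= e.
  have lt2 : (1 - t) * x ord0 i - e < (1 - t) * x ord0 i + e.
    by rewrite ltrD2l gtrN.
  have [v] := rat_in_itvoo lt2; rewrite in_itv/= => /andP[v1 v2].
  by exists v; rewrite ler_distl !ltW.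
exists (\row_i sval (cid (vi i))).
set v := map_mx _ _; have tn0 : t != 0 by rewrite gt_eqF.
rewrite cellE//= unit_ballE.
apply: (@le_trans _ _ (\sum_(i < n) n%:R^-1)); last first.
  by rewrite sumr_const card_ord -[leLHS]mulr_natl divff// gt_eqF.
apply: ler_sum => i _.
have -> : homothety x t^-1 v ord0 i = (v ord0 i - (1 - t) * x ord0 i) / t.
  by rewrite /homothety !mxE; field.
have : `|(v ord0 i - (1 - t) * x ord0 i) / t| <= n%:R^-1.
  rewrite normrM normfV (gtr0_norm t0) ler_pdivrMr// [leRHS]mulrC /v !mxE.
  exact: svalP (cid (vi i)).
move=> h; rewrite -[leLHS](real_normK (num_real _)).
rewrite expr2 (le_trans (ler_pM _ _ h h))// ler_piMl ?invr_ge0 ?(ltW n0)//.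
by rewrite invf_le1// ler1n.
Qed.

Local Open Scope ereal_scope.

(** One preimage outside all the Lipschitz sets is enough for membership, so every image point
    missed by the Lipschitz pieces belongs to it. *)
Definition steep_set : set (set_type (f @` B)) :=
  [set y | exists2 x, B x /\ set_val y = f x &
    forall k : nat, ~ cell_lipschitz_set k.+1%:R x].

Lemma hausdorff_content_steep_set_le (d e : R) : (0 < d)%R -> (0 < e)%R ->
  hausdorff_content n%:R d steep_set <= e%:E.
Proof.
move=> d0 e0.
have D0 : (0 <= D)%R by exact: le_trans (mdist_ge0 _ _) (fD unit_ball0 unit_ball0).
(* The covering sets will be balls of radius 3 r, hence of diameter at most 6 r, which must not
   exceed [d]. *)
have d60 : (0 < d / 6)%R by rewrite divr_gt0.
have [b /andP[b0 b1] osc] := cell_small_oscillation n_gt0 nq sgP Poo d60.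
pose J := fine (\int[mu]_(y in B) P y `^ q).
have J0 : (0 <= J)%R by apply: fine_ge0; apply: integral_ge0.
have JE : \int[mu]_(y in B) P y `^ q = J%:E.
  by rewrite fineK// ge0_fin_numE//; exact: integral_ge0.
pose K (k : R) := (6 ^+ n * ((2 * C) `^ q * k `^ (n%:R - q)))%R.
(* The first condition turns k t <= D for a steep cell into t <= b, so that its radius is at most
   d/6; the second makes the total content at most [e] and is possible because n - q < 0. *)
have [k [Db Ke]] : exists k : nat, (D <= b * k.+1%:R)%R /\ (K k.+1%:R * J <= e)%R.
  pose A := (6 ^+ n * (2 * C) `^ q * J)%R.
  have A0 : (0 <= A)%R by rewrite !mulr_ge0 ?powR_ge0// exprn_ge0.
  have qn0 : (0 < q - n%:R)%R by rewrite subr_gt0.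
  have Ae0 : (0 <= A / e)%R by rewrite divr_ge0// ltW.
  pose w := Num.max (D / b)%R ((A / e) `^ (q - n%:R)^-1)%R.
  exists (Num.truncn w).
  have wk : (w <= (Num.truncn w).+1%:R)%R by exact: ltW (truncnS_gt _).
  move: wk; rewrite ge_max => /andP[w1 w2]; split.
    by rewrite mulrC -ler_pdivrMr.
  set k := (_%:R : R) in w1 w2 *.
  have k0 : (0 < k)%R by rewrite ltr0n.
  have -> : (K k * J = A / k `^ (q - n%:R))%R.
    by rewrite /K /A -(opprB q) powRN; ring.
  rewrite ler_pdivrMr ?powR_gt0// mulrC -ler_pdivrMr//.
  have := @ge0_ler_powR _ (q - n%:R) (ltW qn0) _ _ _ _ w2.
  rewrite !nnegrE powR_ge0 (ltW k0) -powRrM mulVf ?gt_eqF// powRr1//.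
  exact.
have k0 : (0 < k.+1%:R :> R)%R by rewrite ltr0n.
set kk := (k.+1%:R : R) in Db Ke k0 *.
have K0 : (0 <= K kk)%R.
  by rewrite mulr_ge0 ?exprn_ge0// mulr_ge0 ?powR_ge0.
pose N := [set x | B x /\ ~ cell_lipschitz_set kk x].
have extr x : exists tr : R * R, N x -> [/\ (0 < tr.1 <= 1)%R, (0 < tr.2 <= d / 6)%R,
    (forall z, cell x tr.1 z -> mdist (f x) (f z) <= tr.2)%R &
    ((6 * tr.2) ^+ n)%:E <= (K kk)%:E * \int[mu]_(y in cell x tr.1) P y `^ q].
  have [Nx|] := pselect (N x); last by exists (0, 0)%R.
  have [Bx Gx] := Nx; have [t [r [t01 [r0 ktD] cr rc rI]]] := steep_cell k0 Bx Gx.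
  exists (t, r) => _; split => //=.
    rewrite r0/=; apply: rc => z cz; have /andP[t0 _] := t01.
    apply: (osc x t) => //; last exact: cell_center.
    by rewrite t0/= -(ler_pM2r k0) (le_trans _ Db)// mulrC.
  rewrite exprMn EFinM /K (EFinM (6 ^+ n)) -muleA.
  by apply: lee_wpmul2l => //; rewrite lee_fin exprn_ge0.
pose T x := (sval (cid (extr x))).1; pose r x := (sval (cid (extr x))).2.
have trP x : N x -> [/\ (0 < T x <= 1)%R, (0 < r x <= d / 6)%R,
    (forall z, cell x (T x) z -> mdist (f x) (f z) <= r x)%R &
    ((6 * r x) ^+ n)%:E <= (K kk)%:E * \int[mu]_(y in cell x (T x)) P y `^ q].
  exact: svalP (cid (extr x)).
pose meet x y := (mdist (f x) (f y) <= r x + r y)%R.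
have [||x y|S [SN Ssep Scov]] := @vitali_selection R _ N r meet (d / 6)%R.
- by move=> x /trP[].
- by move=> x /trP[_ /andP[r0 _] _ _]; rewrite /meet mdistxx addr_ge0// ltW.
- by rewrite /meet metric_sym addrC.
have exv x : exists v : 'rV[rat]_n, N x -> cell x (T x) (map_mx ratr v).
  have [Nx|] := pselect (N x); last by exists 0%R.
  have [/andP[T0 _] _ _ _] := trP x Nx.
  by have [v cv] := rational_in_cell x T0; exists v.
pose v x := sval (cid (exv x)).
have vP x : N x -> cell x (T x) (map_mx ratr (v x)) by exact: svalP (cid (exv x)).
have disj x y z : S x -> S y -> cell x (T x) z -> cell y (T y) z -> x = y.
  move=> Sx Sy xz yz; apply: Ssep => //; rewrite /meet.
  have [_ _ cx _] := trP x (SN x Sx); have [_ _ cy _] := trP y (SN y Sy).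
  apply: (le_trans (metric_triangle _ (f z) _)); rewrite lerD ?cx//.
  by rewrite metric_sym cy.
(* The cells of S are disjoint, so the rational points [v s] enumerate S. *)
pose I := [set i : nat | exists2 s, S s & i = pickle (v s)].
have exs i : exists s, I i -> S s /\ i = pickle (v s).
  have [[s Ss iE]|] := pselect (I i); last by exists 0%R.
  by exists s.
pose s i := sval (cid (exs i)).
have sP i : I i -> S (s i) /\ i = pickle (v (s i)) by exact: svalP (cid (exs i)).
pose U i : set (set_type (f @` B)) := if i \in I then
  [set y | mdist (f (s i)) (set_val y) <= 3 * r (s i)]%R else set0.
have diam0 : diam (set0 : set (set_type (f @` B))) = 0.
  apply/eqP; rewrite eq_le; apply/andP; split.
    by apply: ge_ereal_sup => _ [->//|[xy [[]]]].
  by apply: ereal_sup_ubound; left.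
have diamU i : I i -> 0 <= diam (U i) <= (6 * r (s i))%:E.
  move=> Ii; have [Ss _] := sP i Ii; have [_ /andP[r0 _] _ _] := trP _ (SN _ Ss).
  rewrite /U mem_set//; apply/andP; split; first by apply: ereal_sup_ubound; left.
  apply: ge_ereal_sup => _ [->|[[y z] [/= hy hz] <-]].
    by rewrite lee_fin mulr_ge0// ltW.
  rewrite lee_fin; apply: (le_trans (@metric_triangle _ X _ (f (s i)) _)).
  rewrite (_ : (6 * r (s i) = 3 * r (s i) + 3 * r (s i))%R); last by ring.
  apply: lerD => //; rewrite metric_sym; exact: hy.
apply: (@le_trans _ _ (\sum_(0 <= i <oo) diam (U i) `^ n%:R)).
  apply: ereal_inf_lbound; exists U => //; split.
    move=> y [x [Bx yx] nG]; have Nx : N x by split; [exact: Bx|exact: nG].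
    have [u Su [xu ru]] := Scov x Nx.
    exists (pickle (v u)) => //.
    have Ii : I (pickle (v u)) by exists u.
    have [Ss pv] := sP _ Ii.
    (* Both points have the same rational point in their cells, and distinct selected cells are
       disjoint. *)
    have su : s (pickle (v u)) = u.
      have vE : v (s (pickle (v u))) = v u.
        by apply/esym; exact: (pcan_inj (@pickleK _) pv).
      apply: (disj _ _ (map_mx ratr (v u))) => //.
        by rewrite -{3}vE; exact: vP (SN _ Ss).
      exact: vP (SN _ Su).
    (* The ball of x meets that of u and r x <= 2 r u, so f x is within r x + r u <= 3 r u of f
       u. *)
    rewrite /U mem_set//= su yx metric_sym (le_trans xu)//.
    by rewrite (_ : (3 * r u = 2 * r u + r u)%R); [rewrite lerD|ring].
  move=> i; have [Ii|nIi] := pselect (I i); last first.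
    by rewrite /U memNset// diam0 lee_fin ltW.
  have /andP[_ /le_trans] := diamU i Ii; apply; rewrite lee_fin.
  have [Ss _] := sP i Ii; have [_ /andP[_ rd] _ _] := trP _ (SN _ Ss).
  by rewrite mulrC -ler_pdivlMr.
rewrite nneseries_esumT; last by move=> i; exact: poweR_ge0.
have mKP : measurable_fun setT (fun y : V => (K kk)%:E * P y `^ q).
  by apply: emeasurable_funM => //; exact: measurable_cst.
have KP0 y : 0 <= (K kk)%:E * P y `^ q by rewrite mule_ge0.
apply: (@le_trans _ _ (\int[mu]_(y in B) ((K kk)%:E * P y `^ q))); last first.
  rewrite ge0_integralZl//; last 2 first.
  - exact: measurable_unit_ball.
  - exact: measurable_funTS.
  by rewrite JE -EFinM lee_fin.
apply: le_trans (esum_cells_le mKP KP0 (x := s) (t := T \o s) (I := I) _ _).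
- rewrite [leRHS]esum_mkcond; apply: le_esum => i _; case: ifPn => [/set_mem Ii|/negP nIi].
    have [Ss _] := sP i Ii; have [/andP[T0 _] /andP[r0 _] _ rI] := trP _ (SN _ Ss).
    have /andP[dU0 dU] := diamU i Ii.
    rewrite ge0_integralZl//; last 2 first.
    - by apply: measurable_cell; rewrite gt_eqF.
    - exact: measurable_funTS.
    apply: le_trans rI.
    rewrite -powR_mulrn ?mulr_ge0 ?(ltW r0)// -poweR_EFin.
    by apply: gt0_ler_poweR; rewrite ?in_itv/= ?leey ?dU0// lee_fin mulr_ge0// ltW.
  by rewrite /U; case: ifPn => [//|_]; rewrite diam0 poweR0r// gt_eqF// ltr0n.
- move=> i Ii; have [Ss _] := sP i Ii; have [T01 _ _ _] := trP _ (SN _ Ss).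
  by have [] := SN _ Ss.
- apply/trivIsetP => i j Ii Ij; apply: contra_neqP => /eqP/set0P[z [zi zj]].
  have [Si iE] := sP i Ii; have [Sj jE] := sP j Ij.
  by rewrite iE jE (disj _ _ z Si Sj zi zj).
Qed.

End lipschitz_pieces.

(** * The image of the ball: boundedness, packing content, rectifiability *)

Lemma unit_ball_image_bounded {R : realType} {n : nat} {X : metricType R}
    {W : completeNormedModType R} (iota : X -> W) (f : 'rV[R]_n -> X) :
  (forall x y, `|iota x - iota y| = mdist x y) ->
  {within @unit_ball R n, continuous f} ->
  exists D : R, forall x y, unit_ball x -> unit_ball y -> mdist (f x) (f y) <= D.
Proof.
move=> isom cf.
have ci : continuous iota.
  move=> x; apply/cvgrPdist_lt => e e0.
  near=> y; rewrite isom; near: y.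
  have := nbhsx_ballx x e e0; rewrite ballEmdist; exact.
(* Compactness gives a norm bound in [W], which the isometry turns into a bound on distances in
   [X]. *)
have /compact_bounded[M [_ bM]] : compact ((iota \o f) @` @unit_ball R n).
  apply: continuous_compact; last exact: compact_unit_ball.
  move=> x; apply: (@continuous_comp (subspace (@unit_ball R n)) X W f iota).
    exact: cf.
  exact: ci.
have fM x : unit_ball x -> `|iota (f x)| <= M + 1.
  by move=> Bx; apply: (bM (M + 1)); [rewrite ltrDl|exists x].
exists ((M + 1) + (M + 1)) => x y Bx By.
by rewrite -isom (le_trans (ler_normB _ _))// lerD ?fM.
Unshelve. all: by end_near. Qed.

Section image_of_unit_ball.
Context {R : realType} {n : nat} {X : metricType R}.
Local Notation V := (borel_rV R n).
Local Notation mu := (lebesgue_rV R n).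
Local Notation B := (@unit_ball R n).
Context (f : 'rV[R]_n -> X) (P : V -> \bar R) (q D : R).
Context (n_gt0 : (0 < n)%N) (nq : n%:R < q).
Context (sgP : segment_gradient f P).
Context (Poo : (\int[mu]_(y in B) P y `^ q < +oo)%E).
Context (fD : forall x y, B x -> B y -> mdist (f x) (f y) <= D).

Lemma finite_packing_content_image :
  finite_packing_content (set_type (f @` B)) n%:R.
Proof.
have D0 : 0 <= D by exact: le_trans (mdist_ge0 _ _) (fD unit_ball0 unit_ball0).
have mB : measurable (B : set V) := measurable_unit_ball.
have mPq : measurable_fun setT (fun y : V => P y `^ q)%E.
  by case: sgP => mP _ _; exact: measurable_poweR_comp.
pose K := @packing_constant R n q D.
pose J := (\int[mu]_(y in B) (1 + P y `^ q))%E.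
have J0 : (0 <= J)%E.
  by apply: integral_ge0 => y _; rewrite adde_ge0// poweR_ge0.
have Joo : (J < +oo)%E.
  rewrite /J ge0_integralD//; last 2 first.
  - by move=> y _; exact: poweR_ge0.
  - exact: measurable_funTS.
  rewrite lte_add_pinfty// integral_cst// mul1e.
  exact: unit_ball_measure_lty.
have JE : J = (fine J)%:E by rewrite fineK// ge0_fin_numE.
(* The absolute value and the added 1 make the constant positive and the final inequality strict. *)
exists (`|K * fine J| + 1); split; first by rewrite ltr_wpDl.
move=> I c r rd tI.
have cx i : exists x, B x /\ f x = set_val (c i).
  by have /set_mem[x Bx fx] := valP (c i); exists x.
pose x i := sval (cid (cx i)).
have xP i : B (x i) /\ f (x i) = set_val (c i) by exact: svalP (cid (cx i)).
apply: (@le_lt_trans _ _ (K%:E * J)%E); last first.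
  by rewrite JE -EFinM lte_fin (le_lt_trans (ler_norm _))// ltrDl.
apply: (packing_sum_le n_gt0 nq sgP Poo D0 (x := x)) => [i Ii|i j z Ii Ij Bz iz jz].
  have [Bx _] := xP i; have [r0 rdi] := rd i Ii; split=> //; rewrite r0/=.
  rewrite -lee_fin (le_trans rdi)//.
  apply: ge_ereal_sup => _ [->|[[y z] _ <-]]; first by rewrite lee_fin.
  have /set_mem[y' By' fy] := valP y; have /set_mem[z' Bz' fz] := valP z.
  rewrite lee_fin (_ : mdist _ _ = mdist (f y') (f z')) ?fD//.
  by rewrite fy fz.
apply: tI => //.
(* A point z of B mapped into both balls yields the point f z of the image in both, so disjointness
   inside the image suffices. *)
exists (exist _ (f z) (mem_set (ex_intro2 _ _ z Bz erefl))).
by split; [move: iz; have [_ ->] := xP i|move: jz; have [_ ->] := xP j].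
Qed.

Lemma rectifiable_image : rectifiable (set_type (f @` B)) n.
Proof.
(* Rectifiability asks for pieces inside the unit cube; this map sends the cube onto [-1, 1]^n,
   which contains the ball, and doubles the Lipschitz constants. *)
pose a (e : 'rV[R]_n) := 2 *: e - const_mx 1.
pose E (k : nat) : set 'rV[R]_n :=
  [set e | unit_cube e /\ cell_lipschitz_set f k.+1%:R (a e)].
have Ef k (e : E k) : f (a (set_val e)) \in f @` B.
  by apply: mem_set; have /set_mem[_ [Be _]] := valP e; exists (a (set_val e)).
pose g k (e : E k) : set_type (f @` B) := exist _ (f (a (set_val e))) (Ef k e).
exists E, g; split.
  move=> k; split=> [e []//|]; exists (k.+1%:R * 2) => e e'.
  have /set_mem[_ Ge] := valP e; have /set_mem[_ Ge'] := valP e'.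
  apply: (le_trans (cell_lipschitz_set_lipschitz Ge Ge')).
  rewrite -mulrA; apply: ler_wpM2l => //.
  have -> : a (\val e) - a (\val e') = 2 *: (set_val e - set_val e').
    by apply/rowP => i; rewrite /a !mxE; ring.
  by rewrite enormZ ger0_norm.
have sub : (~` \bigcup_i range (g i)) `<=` @steep_set R n X f.
  move=> y Ny; have /set_mem[x Bx fx] := valP y; exists x; first by split.
  move=> k Gx; apply: Ny; exists k => //.
  pose e := 2^-1 *: (x + const_mx 1).
  have ae : a e = x by apply/rowP => i; rewrite /a /e !mxE; field.
  have Ee : E k e.
    split; last by rewrite ae.
    move=> i; rewrite /e !mxE.
    by have := unit_ball_coord i Bx; rewrite ler_norml => /andP[]; lra.
  exists (exist _ e (mem_set Ee)) => //; apply: val_inj.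
  by rewrite /= -fx ae.
(* The content vanishes at every scale d > 0, being at most every e > 0, so the limit is that of a
   constant. *)
rewrite /hausdorff_measure; apply: cvg_lim => //; apply: cvg_near_cst.
near=> d; have d0 : 0 < d by near: d; exact: nbhs_right_gt.
apply/eqP; rewrite eq_le; apply/andP; split.
  apply/lee_addgt0Pr => e e0; rewrite add0e.
  apply: le_trans (hausdorff_content_steep_set_le n_gt0 nq sgP Poo fD d0 e0).
  apply: ereal_inf_le_tmp => _ [U [NU dU] <-]; exists U => //; split => //.
  exact: subset_trans NU.
apply: le_ereal_inf_tmp => _ [U _ <-].
by apply: nneseries_ge0 => i _ _; exact: poweR_ge0.
Unshelve. all: by end_near. Qed.

End image_of_unit_ball.

Theorem theorem4p2 (R : realType) (X : metricType R)
    (V : completeNormedModType R) (iota : X -> V)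
    (iota_isometry : forall x y : X, `|iota x - iota y| = mdist x y)
    (X_separable : separable X)
    (n : nat) (n_ge1 : (1 <= n)%N)
    (p : \bar R) (n_lt_p : (n%:R%:E < p)%E)
    (f : 'rV[R]_n -> X)
    (f_sobolev : newton_sobolev iota (@unit_ball R n) p f)
    (f_continuous : {within @unit_ball R n, continuous f}) :
  rectifiable (set_type (f @` @unit_ball R n)) n /\
  finite_packing_content (set_type (f @` @unit_ball R n)) n%:R.
Proof.
have [D fD] := unit_ball_image_bounded iota_isometry f_continuous.
have [P [sgP Poo]] := sobolev_segment_gradient n_lt_p f_sobolev fD.
have nq := lt_finite_exponent n_lt_p.
split; first exact: rectifiable_image n_ge1 nq sgP Poo fD.
exact: finite_packing_content_image n_ge1 nq sgP Poo fD.
Qed.
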